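(* For every $X\in\{v\Delta^\wedge,\ v\Delta^\circ,\ v\sharp,\ vp\}$, any two oriented virtual knots are $X$-equivalent to each other. In particular, the $X$-move is an unknotting operation for oriented virtual knots (that is, every oriented virtual knot is $X$-equivalent to the trivial knot).
   Context: Virtual knots. An oriented virtual knot diagram is a generic immersion of an oriented circle into the plane, each double point of which is either a real crossing (with over/under information) or a virtual crossing. The generalized Reidemeister moves are: the Reidemeister moves I, II, III for real crossings; their analogues in which all crossings are virtual; and the mixed move in which a strand having two virtual crossings is passed across a real crossing. An oriented virtual knot is an equivalence class of diagrams under generalized Reidemeister moves (and planar isotopy). Virtualized $\Delta$-moves. Consider a disk meeting the diagram in three oriented strands, any two of which cross exactly once, so that the three crossings are the vertices of a triangle. A $v\Delta$-move replaces three real crossings, where each of the three strands passes over at one of its two crossings and under at the other, by three virtual crossings, or is the inverse of this replacement. It is a $v\Delta^\circ$-move if the three sides of the triangle, with the orientations of the strands, form a coherently oriented cycle (equivalently, the three real crossings have the same sign); otherwise it is a $v\Delta^\wedge$-move. Virtualized $\sharp$- and pass-moves. Consider a disk meeting the diagram in a pair of parallel, disjoint strands and another pair of parallel, disjoint strands, where each strand of the first pair crosses each strand of the second pair exactly once. The move in question replaces four real crossings at which both strands of the first pair pass over both strands of the second pair by four virtual crossings, or is the inverse of this replacement. It is a $v\sharp$-move if within each pair the two strands are oriented in the same direction, and a $vp$-move if within each pair the two strands are oriented in opposite directions. Two oriented virtual knots are $X$-equivalent if their diagrams are related by a finite sequence of $X$-moves and generalized Reidemeister moves. *)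

(* Defs.v *)
From mathcomp Require Import all_boot.
From Stdlib Require Export Relations.Relation_Operators.

Set Implicit Arguments.
Unset Strict Implicit.
Unset Printing Implicit Defensive.

(* Oriented virtual link diagrams in the plane, in Morse position.

   A generic immersed oriented closed curve is put in general position with
   respect to the height function of the plane, so that at most one event
   (local minimum, local maximum, or double point, where both strands are
   transverse to the horizontal) occurs at each height.  Read from bottom to
   top, the diagram is a sequence of layers, each containing one event and a
   number of vertical strands on its left and on its right.

   A horizontal line crossing the diagram sees a sequence of oriented strands,
   recorded as a [seq bool]: [true] is a strand oriented upwards. *)

(* [Real true] is a real crossing whose over strand runs from bottom left to
   top right (/), [Real false] one whose over strand runs from bottom right to
   top left (\). *)
Inductive crossing := Real of bool | Virtual.

(* The type of the same crossing when its two strands exchange slopes. *)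
Definition flip (c : crossing) : crossing :=
  if c is Real x then Real (~~ x) else Virtual.

(* [Cup b]: local minimum, left leg of orientation [b].
   [Cap b]: local maximum, left leg of orientation [b].
   [Cross c a b]: double point; the strand / has orientation [a], the
   strand \ has orientation [b]. *)
Inductive event :=
  | Cup of bool
  | Cap of bool
  | Cross of crossing & bool & bool.

Definition event_src (e : event) : seq bool :=
  match e with
  | Cup _ => [::]
  | Cap b => [:: b; ~~ b]
  | Cross _ a b => [:: a; b]
  end.

Definition event_tgt (e : event) : seq bool :=
  match e with
  | Cup b => [:: b; ~~ b]
  | Cap _ => [::]
  | Cross _ a b => [:: b; a]
  end.

Record layer := Layer {
  lstrands : seq bool;
  levent : event;
  rstrands : seq bool
}.

Definition layer_src (l : layer) : seq bool :=
  lstrands l ++ event_src (levent l) ++ rstrands l.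
Definition layer_tgt (l : layer) : seq bool :=
  lstrands l ++ event_tgt (levent l) ++ rstrands l.

Definition tangle := seq layer.

Fixpoint tangle_wf (s : seq bool) (T : tangle) (t : seq bool) : bool :=
  if T is l :: T' then (s == layer_src l) && tangle_wf (layer_tgt l) T' t
  else s == t.

Record diagram := Diagram {
  layers :> tangle;
  layersP : tangle_wf [::] layers [::]
}.

Definition layer0 : layer := Layer [::] (Cup true) [::].

(* The points of a diagram are its intersections with the horizontal lines
   separating layers: (i, k) is the k-th strand, from the left, just below
   layer i.  ([layer0] is only a default for [nth].) *)
Definition is_point (T : tangle) (p : nat * nat) : bool :=
  (p.1 < size T) && (p.2 < size (layer_src (nth layer0 T p.1))).

(* Arcs of the curve inside one layer; an endpoint is (false, k) on the bottom
   line and (true, k) on the top line of the layer. *)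
Inductive layer_arc (l : layer) : bool * nat -> bool * nat -> Prop :=
  | Arc_left k of k < size (lstrands l) : layer_arc l (false, k) (true, k)
  | Arc_right k of k < size (rstrands l) :
      layer_arc l
        (false, size (lstrands l) + size (event_src (levent l)) + k)
        (true, size (lstrands l) + size (event_tgt (levent l)) + k)
  | Arc_cup b of levent l = Cup b :
      layer_arc l (true, size (lstrands l)) (true, (size (lstrands l)).+1)
  | Arc_cap b of levent l = Cap b :
      layer_arc l (false, size (lstrands l)) (false, (size (lstrands l)).+1)
  | Arc_slash c a b of levent l = Cross c a b :
      layer_arc l (false, size (lstrands l)) (true, (size (lstrands l)).+1)
  | Arc_backslash c a b of levent l = Cross c a b :
      layer_arc l (false, (size (lstrands l)).+1) (true, size (lstrands l)).

Inductive adjacent (T : tangle) : nat * nat -> nat * nat -> Prop :=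
  | Adjacent i s k s' k' of i < size T
      & layer_arc (nth layer0 T i) (s, k) (s', k') :
      adjacent T (i + nat_of_bool s, k) (i + nat_of_bool s', k').

Definition one_component (D : diagram) : Prop :=
  layers D <> [::] /\
  forall p q, is_point D p -> is_point D q ->
    clos_refl_sym_trans _ (adjacent D) p q.

(* [T] with vertical strands [u] added on its left and [v] on its right. *)
Definition whisker (u v : seq bool) (T : tangle) : tangle :=
  [seq Layer (u ++ lstrands l) (levent l) (rstrands l ++ v) | l <- T].

(* [M] relates tangles with the same boundary; the disk is a box with T inside,
   with the vertical strands u and v beside it. *)
Inductive in_disk (M : tangle -> tangle -> Prop) (D D' : diagram) : Prop :=
  | InDisk B A u v T T' of M T T'
      & layers D = B ++ whisker u v T ++ A
      & layers D' = B ++ whisker u v T' ++ A.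

(* The moves generating planar isotopy for diagrams in Morse position: two
   distant events exchange their heights; a pair consisting of a maximum and
   an adjacent minimum is cancelled; a crossing passes through the maximum, or
   the minimum, of one of its strands (Turaev; Freyd and Yetter).  Since these
   moves rotate a disk, the moves below are stated for one position of their
   disk only. *)
Inductive planar_isotopy : tangle -> tangle -> Prop :=
  | Iso_exchange e f m : planar_isotopy
      [:: Layer [::] e (m ++ event_src f); Layer (event_tgt e ++ m) f [::]]
      [:: Layer (event_src e ++ m) f [::]; Layer [::] e (m ++ event_tgt f)]
  | Iso_zigzag_right a : planar_isotopy
      [:: Layer [:: a] (Cup (~~ a)) [::]; Layer [::] (Cap a) [:: a]]
      [::]
  | Iso_zigzag_left a : planar_isotopy
      [:: Layer [::] (Cup a) [:: a]; Layer [:: a] (Cap (~~ a)) [::]]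
      [::]
  | Iso_cap c a b : planar_isotopy
      [:: Layer [::] (Cross c a b) [:: ~~ a]; Layer [:: b] (Cap a) [::]]
      [:: Layer [:: a] (Cross (flip c) b (~~ a)) [::]; Layer [::] (Cap a) [:: b]]
  | Iso_cup c a b : planar_isotopy
      [:: Layer [:: b] (Cup a) [::]; Layer [::] (Cross c b a) [:: ~~ a]]
      [:: Layer [::] (Cup a) [:: b]; Layer [:: a] (Cross (flip c) (~~ a) b) [::]].

(* Three strands 1, 2, 3, numbered from left to right along the bottom line,
   of orientations a1, a2, a3, any two of which cross once; cij is the crossing
   of strands i and j, in which strand i (i < j) is the strand /.  The two
   tangles are the two triangles formed by such strands: the middle crossing
   c13 is the right vertex of the first and the left vertex of the second. *)
Definition triangle_r (c12 c13 c23 : crossing) (a1 a2 a3 : bool) : tangle :=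
  [:: Layer [::] (Cross c12 a1 a2) [:: a3];
      Layer [:: a2] (Cross c13 a1 a3) [::];
      Layer [::] (Cross c23 a2 a3) [:: a1]].

Definition triangle_l (c12 c13 c23 : crossing) (a1 a2 a3 : bool) : tangle :=
  [:: Layer [:: a1] (Cross c23 a2 a3) [::];
      Layer [::] (Cross c13 a1 a3) [:: a2];
      Layer [:: a3] (Cross c12 a1 a2) [::]].

(* [Real o12], [Real o13], [Real o23] are such that each of the three strands
   is over at one of its crossings and under at the other: 1 over 2 over 3
   over 1, or 1 under 2 under 3 under 1. *)
Definition cyclic_crossings (o12 o13 o23 : bool) : bool :=
  (o12 == o23) && (o13 != o12).

(* Real moves: the three strands have a top, a middle and a bottom one.
   Virtual move: three virtual crossings.  Mixed moves: one real crossing, the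
   strand not taking part in it having two virtual crossings. *)
Definition R3_crossings (c12 c13 c23 : crossing) : bool :=
  match c12, c13, c23 with
  | Real o12, Real o13, Real o23 => ~~ cyclic_crossings o12 o13 o23
  | Virtual, Virtual, Virtual => true
  | Real _, Virtual, Virtual => true
  | Virtual, Real _, Virtual => true
  | Virtual, Virtual, Real _ => true
  | _, _, _ => false
  end.

(* In the moves I and II, [c] is real or virtual. *)
Inductive generalized_reidemeister : tangle -> tangle -> Prop :=
  | R1_right c a : generalized_reidemeister
      [:: Layer [:: a] (Cup a) [::];
          Layer [::] (Cross c a a) [:: ~~ a];
          Layer [:: a] (Cap a) [::]]
      [::]
  | R1_left c a : generalized_reidemeister
      [:: Layer [::] (Cup (~~ a)) [:: a];
          Layer [:: ~~ a] (Cross c a a) [::];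
          Layer [::] (Cap (~~ a)) [:: a]]
      [::]
  | R2 c a b : generalized_reidemeister
      [:: Layer [::] (Cross c a b) [::]; Layer [::] (Cross (flip c) b a) [::]]
      [::]
  | R3 c12 c13 c23 a1 a2 a3 of R3_crossings c12 c13 c23 :
      generalized_reidemeister
        (triangle_r c12 c13 c23 a1 a2 a3)
        (triangle_l c12 c13 c23 a1 a2 a3).

Definition diagram_step (D D' : diagram) : Prop :=
  in_disk planar_isotopy D D' \/ in_disk generalized_reidemeister D D'.

Definition diagram_equiv : diagram -> diagram -> Prop :=
  clos_refl_sym_trans diagram diagram_step.

(* The class of a diagram with one component.  The moves of [diagram_equiv]
   preserve the number of components, so every member is a knot diagram. *)
Record virtual_knot := VirtualKnot {
  represents : diagram -> Prop;
  virtual_knotP : exists D, one_component D /\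
    forall D', represents D' <-> diagram_equiv D D'
}.

Inductive xmove := vDelta_wedge | vDelta_circ | vSharp | vPass.

(* The sides of the triangle [triangle_r] lie on strand 1, from crossing 12 to
   crossing 13 when followed upwards; on strand 2, from 12 to 23; on strand 3,
   from 13 to 23.  Hence they form an oriented cycle exactly when strands 1 and
   3 have the same vertical direction and strand 2 the opposite one.  The same
   condition holds for [triangle_l], where the sides followed upwards run from
   13 to 12, from 23 to 12 and from 23 to 13. *)
Definition coherent (a1 a2 a3 : bool) : bool := (a1 == a3) && (a2 != a1).

(* A pair of parallel strands of orientations a1, a2, entering at the bottom
   left, crosses a pair of parallel strands of orientations b1, b2, entering
   at the bottom right; the four crossings are all of type [c], the strands of
   the first pair being the strands /. *)
Definition square (c : crossing) (a1 a2 b1 b2 : bool) : tangle :=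
  [:: Layer [:: a1] (Cross c a2 b1) [:: b2];
      Layer [::] (Cross c a1 b1) [:: a2; b2];
      Layer [:: b1; a1] (Cross c a2 b2) [::];
      Layer [:: b1] (Cross c a1 b2) [:: a2]].

Inductive x_move : xmove -> tangle -> tangle -> Prop :=
  | X_triangle_r o12 o13 o23 a1 a2 a3 of cyclic_crossings o12 o13 o23 :
      x_move (if coherent a1 a2 a3 then vDelta_circ else vDelta_wedge)
        (triangle_r (Real o12) (Real o13) (Real o23) a1 a2 a3)
        (triangle_r Virtual Virtual Virtual a1 a2 a3)
  | X_triangle_l o12 o13 o23 a1 a2 a3 of cyclic_crossings o12 o13 o23 :
      x_move (if coherent a1 a2 a3 then vDelta_circ else vDelta_wedge)
        (triangle_l (Real o12) (Real o13) (Real o23) a1 a2 a3)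
        (triangle_l Virtual Virtual Virtual a1 a2 a3)
  | X_sharp o a b :
      x_move vSharp (square (Real o) a a b b) (square Virtual a a b b)
  | X_pass o a b :
      x_move vPass (square (Real o) a (~~ a) b (~~ b))
        (square Virtual a (~~ a) b (~~ b)).

Definition x_step (X : xmove) (D D' : diagram) : Prop :=
  in_disk (x_move X) D D' \/ diagram_step D D'.

Definition x_equivalent (X : xmove) (K K' : virtual_knot) : Prop :=
  exists D D', [/\ represents K D, represents K' D' &
    clos_refl_sym_trans diagram (x_step X) D D'].

Definition circle : diagram :=
  @Diagram [:: Layer [::] (Cup true) [::]; Layer [::] (Cap true) [::]] isT.

Lemma circle_one_component : one_component circle.
Proof.
split=> // p q.
have pointE r : is_point circle r -> r = (1, 0) \/ r = (1, 1).
  by case: r => [[|[|i]] [|[|k]]] //=; auto.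
have h : adjacent circle (1, 0) (1, 1).
  by apply: (@Adjacent circle 0 true 0 true 1) => //; exact: (Arc_cup (b := true)).
move=> /pointE [] -> /pointE [] ->; [exact: rst_refl | exact: rst_step |
  exact/rst_sym/rst_step | exact: rst_refl].
Qed.

Definition trivial_knot : virtual_knot :=
  @VirtualKnot (diagram_equiv circle)
    (ex_intro _ circle (conj circle_one_component
      (fun D' => conj id id))).

(* Main.v *)
(* Each of the four moves makes a triangle with three strands of orientations
   (b, c, b) virtual, for every b and a fixed c = b or c = -b: directly for the
   Delta-moves, after joining two of the four strands by a kink for the others.
   Joining the first and the third strand of this triangle gives the crossing
   change, so real crossings may be regarded as flat.

   Keep one strand x of the knot vertical, at the left of the rest of the diagram.
   By the flat triangle, a flat crossing of two strands is a virtual crossing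
   together with one bead on each of them, a bead being a flat crossing of the
   strand with x, reached and left through virtual crossings.  The left and right
   versions of the triangle give the two beads in opposite orders, so beads on
   different strands commute.  Beads slide along their strand, so they never
   obstruct the purely virtual diagram, which reduces to disjoint arcs, read from
   bottom to top.  As there is one component, only the arc that continues x is
   left at the end; a bead on it is an isolated chord, removed by move I. *)

From mathcomp Require Import all_boot zify.
From Stdlib Require Import Setoid Morphisms.
Require Import Defs.

Set Implicit Arguments.
Unset Strict Implicit.
Unset Printing Implicit Defensive.

(** The strand x comes from a zigzag inserted right above the first minimum: its maximum is pushed
    to the top of the diagram, so that all later events are shifted by two strands and never touch
    the leftmost one. The flat triangle is available for one pattern of orientations only, whereas x
    has a fixed one. A crossing with other orientations is given quarter turns, which bend one of
    its strands, and its beads are carried around the bends. This is why beads have two types,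
    exchanged at a minimum. Before a maximum, both of its strands are freed of beads: each bead goes
    down its arc and up to the other end. So beads turn at minima only. The procedure would fail at
    a maximum that closes an arc on itself, splitting off a component. Rewriting loses the original
    diagram, so connectedness is carried along as the set of two-colourings of the strands, which
    every move preserves: a closed arc could be coloured independently of x. *)

Lemma tangle_wf_cat s T r U t :
  tangle_wf s T r -> tangle_wf r U t -> tangle_wf s (T ++ U) t.
Proof.
elim: T s => [|l T IH] s /=; first by move/eqP->.
by case/andP=> -> /IH h /h.
Qed.

Lemma tangle_wf_whisker u v s T t :
  tangle_wf s T t -> tangle_wf (u ++ s ++ v) (whisker u v T) (u ++ t ++ v).
Proof.
elim: T s => [|l T IH] s /=; first by move/eqP->.
case/andP=> /eqP-> /IH.
by rewrite /layer_src /layer_tgt /= -!catA eqxx.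
Qed.

Lemma whisker_whisker u v u' v' T :
  whisker u v (whisker u' v' T) = whisker (u ++ u') (v' ++ v) T.
Proof.
by rewrite /whisker -map_comp; apply: eq_map => l /=; rewrite !catA.
Qed.

Lemma whisker_cat u v T U : whisker u v (T ++ U) = whisker u v T ++ whisker u v U.
Proof. exact: map_cat. Qed.

(** * Words in Morse events *)

Inductive kind := Kcup of bool | Kcap | Kcross of crossing.

(* A generator places an event of the given kind with [n] strands on its left.
   The strands of a layer are not recorded: they are determined by the source
   of the word, so that moves become equations between words which do not
   mention orientations. *)
Definition gen := (nat * kind)%type.
Definition word := seq gen.

Definition ksrc (K : kind) := if K is Kcup _ then 0 else 2.
Definition ktgt (K : kind) := if K is Kcap then 0 else 2.

Definition event_kind (e : event) : kind :=
  match e with Cup b => Kcup b | Cap _ => Kcap | Cross c _ _ => Kcross c end.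

(** Only a maximum rejects orientations; minima and crossings only need enough strands. *)
Definition kevent (K : kind) (m : seq bool) : option event :=
  match K, m with
  | Kcup b, [::] => Some (Cup b)
  | Kcap, [:: x; y] => if y == ~~ x then Some (Cap x) else None
  | Kcross c, [:: x; y] => Some (Cross c x y)
  | _, _ => None
  end.

Lemma keventP K m e : kevent K m = Some e -> m = event_src e /\ K = event_kind e.
Proof.
case: K m => [b||c] [|x [|y [|z m]]] //=.
- by case=> <-.
- by case: eqP => // -> [<-].
- by case=> <-.
Qed.

Lemma kevent_src e : kevent (event_kind e) (event_src e) = Some e.
Proof. by case: e => //= b; rewrite eqxx. Qed.

Lemma size_event_src e : size (event_src e) = ksrc (event_kind e).
Proof. by case: e. Qed.

Lemma size_event_tgt e : size (event_tgt e) = ktgt (event_kind e).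
Proof. by case: e. Qed.

Definition gmid (s : seq bool) (g : gen) := take (ksrc g.2) (drop g.1 s).

Definition gok (s : seq bool) (g : gen) : bool :=
  (g.1 + ksrc g.2 <= size s) && kevent g.2 (gmid s g).

(** [Cup true] is a filler, reached only when [gok] fails. *)
Definition glayer (s : seq bool) (g : gen) : layer :=
  Layer (take g.1 s) (odflt (Cup true) (kevent g.2 (gmid s g)))
    (drop (g.1 + ksrc g.2) s).

Definition gtgt (s : seq bool) (g : gen) := layer_tgt (glayer s g).

Fixpoint ok (s : seq bool) (w : word) : bool :=
  if w is g :: w' then gok s g && ok (gtgt s g) w' else true.
Fixpoint tgt (s : seq bool) (w : word) : seq bool :=
  if w is g :: w' then tgt (gtgt s g) w' else s.
Fixpoint interp (s : seq bool) (w : word) : tangle :=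
  if w is g :: w' then glayer s g :: interp (gtgt s g) w' else [::].

Lemma gok_split s g : gok s g ->
  exists u e v, [/\ s = u ++ event_src e ++ v, g = (size u, event_kind e),
    glayer s g = Layer u e v & gtgt s g = u ++ event_tgt e ++ v].
Proof.
case: g => n K; rewrite /gok /gtgt /glayer /gmid /= => /andP[h].
case E: kevent => [e|] // _; have [Em EK] := keventP E.
exists (take n s), e, (drop (n + ksrc K) s); split=> //.
- by rewrite -Em addnC -drop_drop !cat_take_drop.
- by rewrite size_takel ?EK //; lia.
Qed.

Lemma glayer_cat u e v : let g := (size u, event_kind e) in let s := u ++ event_src e ++ v in
  [/\ gok s g, glayer s g = Layer u e v & gtgt s g = u ++ event_tgt e ++ v].
Proof.
rewrite /gok /gtgt /glayer /gmid /= drop_size_cat // take_size_cat //.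
rewrite !size_cat -size_event_src take_size_cat // kevent_src /= andbT.
rewrite addnC -drop_drop !drop_size_cat //; by split=> //; lia.
exact: size_event_src.
Qed.

Lemma layer_src_glayer s g : gok s g -> layer_src (glayer s g) = s.
Proof. by case/gok_split=> u [e] [v] [-> _ ->]. Qed.

Lemma ok_wf s w : ok s w -> tangle_wf s (interp s w) (tgt s w).
Proof.
elim: w s => [|g w IH] s //= /andP[h /IH].
by rewrite layer_src_glayer // eqxx.
Qed.

Lemma ok_cat s w w' : ok s (w ++ w') = ok s w && ok (tgt s w) w'.
Proof. by elim: w s => //= g w IH s; rewrite IH andbA. Qed.
Lemma tgt_cat s w w' : tgt s (w ++ w') = tgt (tgt s w) w'.
Proof. by elim: w s => //=. Qed.
Lemma interp_cat s w w' : interp s (w ++ w') = interp s w ++ interp (tgt s w) w'.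
Proof. by elim: w s => //= g w IH s; rewrite IH. Qed.

Definition layer_gen (l : layer) : gen := (size (lstrands l), event_kind (levent l)).

(** Forgetting the strands of the layers loses nothing, so every diagram can be treated as a
    word. *)
Lemma interp_layer_gen s T t : tangle_wf s T t -> let w := map layer_gen T in
  [/\ ok s w, tgt s w = t & interp s w = T].
Proof.
elim: T s => [|l T IH] s /=; first by move/eqP.
case/andP=> /eqP-> /IH[h1 h2 h3].
case: l h1 h2 h3 => u e v; rewrite /layer_gen /layer_src /=.
by have [-> -> ->] := glayer_cat u e v; rewrite /layer_tgt /= => -> -> ->.
Qed.

Fixpoint wsize (k : nat) (w : word) : option nat :=
  if w is g :: w' then
    if g.1 + ksrc g.2 <= k then wsize (k - ksrc g.2 + ktgt g.2) w' else None
  else Some k.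

Lemma size_gtgt s g : gok s g -> size (gtgt s g) = size s - ksrc g.2 + ktgt g.2.
Proof.
case/gok_split=> u [e] [v] [-> -> _ ->] /=.
rewrite !size_cat size_event_tgt size_event_src; lia.
Qed.

Lemma ok_wsize s w : ok s w -> wsize (size s) w = Some (size (tgt s w)).
Proof.
elim: w s => [|g w IH] s //= /andP[h /IH].
by rewrite size_gtgt // (_ : g.1 + _ <= _) //; case/andP: h.
Qed.

(** Orientations matter at maxima only, so for these words [ok] is a count of strands; relations
    between them are then reversed by a numerical check. *)
Definition capless (w : word) : bool := all (fun g : gen => if g.2 is Kcap then false else true) w.
Arguments capless w : simpl never.

Lemma capless_cat w w' : capless (w ++ w') = capless w && capless w'.
Proof. exact: all_cat. Qed.
Lemma capless_cons n K w : capless ((n, K) :: w) = (if K is Kcap then false else true) && capless w.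
Proof. by []. Qed.
Lemma capless_nil : capless [::].
Proof. by []. Qed.

Lemma ok_capless s w : capless w ->
  ok s w = isSome (wsize (size s) w).
Proof.
elim: w s => [|[n K] w IH] s //=; rewrite capless_cons => /andP[hK /IH{}IH].
rewrite IH; case: leqP => h; last by rewrite /gok /= leqNgt h.
have hg : gok s (n, K).
  rewrite /gok h /gmid /=; have : size (take (ksrc K) (drop n s)) = ksrc K.
    by rewrite size_takel // size_drop; lia.
  by case: K hK {IH h} => //= [b _|c _]; [case: take | case: take => [|x [|y []]]].
by rewrite hg size_gtgt.
Qed.

Definition shift (k : nat) (w : word) : word := [seq (k + g.1, g.2) | g <- w].

Lemma shift_cat k w w' : shift k (w ++ w') = shift k w ++ shift k w'.
Proof. exact: map_cat. Qed.
Lemma shift0 w : shift 0 w = w.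
Proof. by rewrite /shift -[RHS]map_id; apply: eq_map => -[]. Qed.

Section Local.
Context (u s v : seq bool).

Lemma gwindow n k : n + k <= size s ->
  [/\ take (size u + n) (u ++ s ++ v) = u ++ take n s,
      take k (drop (size u + n) (u ++ s ++ v)) = take k (drop n s)
    & drop (size u + n + k) (u ++ s ++ v) = drop (n + k) s ++ v].
Proof.
move=> h; have dE j : drop (size u + j) (u ++ s ++ v) = drop j (s ++ v).
  by rewrite addnC -drop_drop drop_size_cat.
have dE' j : j <= size s -> drop j (s ++ v) = drop j s ++ v.
  rewrite drop_cat; case: ltnP => // h1 h2.
  by rewrite (drop_oversize h1) (_ : j - _ = 0) ?drop0 //; lia.
have tE : take (size u + n) (u ++ s ++ v) = u ++ take n s.
  by rewrite take_cat ifF ?addKn ?takel_cat //; lia.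
by rewrite -addnA tE !dE !dE' ?takel_cat ?size_drop //; lia.
Qed.

Lemma glocal g : g.1 + ksrc g.2 <= size s ->
  let g' := (size u + g.1, g.2) in
  [/\ gok (u ++ s ++ v) g' = gok s g,
      glayer (u ++ s ++ v) g' =
        Layer (u ++ lstrands (glayer s g)) (levent (glayer s g))
          (rstrands (glayer s g) ++ v)
    & gtgt (u ++ s ++ v) g' = u ++ gtgt s g ++ v].
Proof.
case: g => n K /= h; have [h1 h2 h3] := gwindow h.
rewrite /gok /gtgt /glayer /gmid /layer_tgt /= h1 h2 h3 /= h !size_cat.
by rewrite -!catA; split=> //; congr (_ && _); lia.
Qed.
End Local.

Lemma ok_shift u s v w : wsize (size s) w ->
  ok (u ++ s ++ v) (shift (size u) w) = ok s w.
Proof.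
elim: w s => [|g w IH] s //=; case: leqP => // h hw.
have [-> _ ->] := glocal u v h; case hg: gok => //=.
by rewrite IH // size_gtgt.
Qed.

Lemma ok_shiftE u s v w : ok s w ->
  [/\ ok (u ++ s ++ v) (shift (size u) w),
      tgt (u ++ s ++ v) (shift (size u) w) = u ++ tgt s w ++ v
    & interp (u ++ s ++ v) (shift (size u) w) = whisker u v (interp s w)].
Proof.
elim: w s => [|g w IH] s //= /andP[hg hw].
have h : g.1 + ksrc g.2 <= size s by case/andP: hg.
have [-> -> ->] := glocal u v h; have [-> -> ->] := IH _ hw.
by rewrite hg.
Qed.

(* [cout w m] lists the colourings of the top strands that extend the colouring [m]
   of the bottom ones to a two-colouring constant along the curve.  Colourings are
   all that is kept of the connectedness of a diagram. *)
Definition kcout (K : kind) (m : seq bool) : seq (seq bool) :=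
  match K, m with
  | Kcup _, [::] => [:: [:: true; true]; [:: false; false]]
  | Kcap, [:: x; y] => if x == y then [:: [::]] else [::]
  | Kcross _, [:: x; y] => [:: [:: y; x]]
  | _, _ => [::]
  end.

Definition gcout (g : gen) (m : seq bool) : seq (seq bool) :=
  [seq take g.1 m ++ e ++ drop (g.1 + ksrc g.2) m | e <- kcout g.2 (gmid m g)].

Fixpoint cout (w : word) (m : seq bool) : seq (seq bool) :=
  if w is g :: w' then flatten [seq cout w' m' | m' <- gcout g m] else [:: m].

Lemma cout_cat w w' m m' :
  reflect (exists2 m1, m1 \in cout w m & m' \in cout w' m1) (m' \in cout (w ++ w') m).
Proof.
elim: w m => [|g w IH] m /=.
  apply: (iffP idP) => [h|[m1]]; first by exists m; rewrite ?inE.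
  by rewrite inE => /eqP->.
apply: (iffP flatten_mapP) => [[m1 h1 /IH[m2 h2 h3]]|[m2 /flatten_mapP[m1 h1 h2] h3]].
  by exists m2 => //; apply/flatten_mapP; exists m1.
by exists m1 => //; apply/IH; exists m2.
Qed.

Lemma size_kcout K m e : e \in kcout K m -> size e = ktgt K.
Proof.
case: K m => [b||c] [|x [|y [|z m]]] //=; rewrite ?inE //.
- by case/orP=> /eqP->.
- by case: eqP; rewrite ?inE // => _ /eqP->.
- by move=> /eqP->.
Qed.

Lemma size_gcout g m m' : g.1 + ksrc g.2 <= size m -> m' \in gcout g m ->
  size m' = size m - ksrc g.2 + ktgt g.2.
Proof.
move=> h /mapP[e /size_kcout he ->]; rewrite !size_cat he size_drop size_takel; move: h; set a := size _; set b := ksrc _; set c := g.1; clear; lia.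
Qed.

Lemma size_cout w m m' k : wsize (size m) w = Some k -> m' \in cout w m -> size m' = k.
Proof.
elim: w m => [|g w IH] m /=; first by case=> <-; rewrite inE => /eqP->.
case: leqP => // h hw /flatten_mapP[m1 /(size_gcout h) h1].
by apply: IH; rewrite h1.
Qed.

Lemma cout_shift u m v w : wsize (size m) w ->
  cout (shift (size u) w) (u ++ m ++ v) = [seq u ++ e ++ v | e <- cout w m].
Proof.
elim: w m => [|g w IH] m //=; case: leqP => // h hw.
have [h1 h2 h3] := gwindow u v h.
rewrite /gcout /gmid /= h1 h2 h3 map_flatten -!map_comp; congr flatten.
apply/eq_in_map => e he /=; rewrite -IH -?catA //.
rewrite (@size_gcout g m) //; exact: map_f.
Qed.

(** * Equivalence of tangles with boundary and rewriting of words *)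

Definition move (X : xmove) (T T' : tangle) : Prop :=
  [\/ planar_isotopy T T', generalized_reidemeister T T' | x_move X T T'].

Section Equivalence.
Context (X : xmove).

(** The analogue of [x_step] for tangles with boundary, so that relations can be derived on a few
    strands and put into a context afterwards. *)
Inductive tstep (s t : seq bool) (T T' : tangle) : Prop :=
  TStep B A u v L R of tangle_wf s T t & tangle_wf s T' t & move X L R
    & T = B ++ whisker u v L ++ A & T' = B ++ whisker u v R ++ A.

Definition tequiv s t := clos_refl_sym_trans tangle (tstep s t).

Lemma tequiv_wf s t T T' : tequiv s t T T' -> tangle_wf s T t = tangle_wf s T' t.
Proof. by elim=> [T1 T2 [B A u v L R -> ->]|||T1 T2 T3 _ ->]. Qed.

Lemma tequiv_ctx s t s' t' B A u v T T' :
  tangle_wf s B (u ++ s' ++ v) -> tangle_wf (u ++ t' ++ v) A t ->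
  tequiv s' t' T T' ->
  tequiv s t (B ++ whisker u v T ++ A) (B ++ whisker u v T' ++ A).
Proof.
move=> hB hA; elim=> [{}T {}T'|{}T|{}T {}T' _ h|T1 T2 T3 _ h12 _ h23].
- case=> B' A' u' v' L R h1 h2 hM ET ET'; apply: rst_step.
  have wfC W : tangle_wf s' W t' -> tangle_wf s (B ++ whisker u v W ++ A) t.
    by move=> hW; apply: tangle_wf_cat hB (tangle_wf_cat (tangle_wf_whisker _ _ hW) hA).
  exists (B ++ whisker u v B') (whisker u v A' ++ A) (u ++ u') (v' ++ v) L R => //.
  + exact: wfC.
  + exact: wfC.
  + by rewrite ET !whisker_cat whisker_whisker -!catA.
  + by rewrite ET' !whisker_cat whisker_whisker -!catA.
- exact: rst_refl.
- exact: rst_sym.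
- exact: rst_trans h12 h23.
Qed.

Lemma tequiv_diagram (D D' : diagram) : tequiv [::] [::] D D' ->
  clos_refl_sym_trans diagram (x_step X) D D'.
Proof.
case: D D' => [T p] [T' p'] /= h.
elim: h p p' => [{}T {}T'|{}T|{}T {}T' _ h|T1 T2 T3 h12 IH12 _ IH23].
- case=> B A u v L R _ _ hM ET ET' p p'; apply: rst_step.
  case: hM => hM; [right; left|right; right|left]; exact: (@InDisk _ _ _ B A u v L R).
- by move=> p p'; rewrite (bool_irrelevance p p'); exact: rst_refl.
- by move=> p p'; exact: rst_sym.
- move=> p p'; have p2 : tangle_wf [::] T2 [::] by rewrite -(tequiv_wf h12).
  exact: rst_trans (IH12 p p2) (IH23 p2 p').
Qed.

(** The clause on [cout] makes two-colourings invariant under rewriting; this is how connectedness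
    reaches the normal forms. *)
Record refs (s : seq bool) (w w' : word) : Prop := Refs { refsP : ok s w ->
  [/\ ok s w', tgt s w' = tgt s w, tequiv s (tgt s w) (interp s w) (interp s w')
    & forall m, size m = size s -> cout w m =i cout w' m] }.

(* Not symmetric: cancelling moves such as the second Reidemeister move may
   enlarge the set of sources on which a word makes sense. *)
Record ref (w w' : word) : Prop := Ref { refP : forall s, refs s w w' }.

Lemma refs_refl s w : refs s w w.
Proof. by split=> h; split=> //; exact: rst_refl. Qed.

Lemma refs_trans s w1 w2 w3 : refs s w1 w2 -> refs s w2 w3 -> refs s w1 w3.
Proof.
move=> [h12] [h23]; split=> /h12[/h23[h1 h2 h3 h4] k2 k3 k4]; split=> //.
- by rewrite h2.
- by apply: rst_trans k3 _; rewrite -k2.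
- by move=> m hm m'; rewrite k4 // h4.
Qed.

Lemma refs_rev s w w' : refs s w' w -> (ok s w -> ok s w') -> refs s w w'.
Proof.
move=> [h] hok; split=> /[dup] h1 /hok /[dup] h2 /h[_ h3 h4 h5]; split=> //.
- by apply: rst_sym; rewrite h3.
- by move=> m hm m'; rewrite h5.
Qed.

Lemma refs_cat s w1 w1' w2 w2' : refs s w1 w1' -> refs (tgt s w1) w2 w2' ->
  refs s (w1 ++ w2) (w1' ++ w2').
Proof.
move=> [h] [h']; split; rewrite !ok_cat !tgt_cat !interp_cat => /andP[h1 h2].
have [k1 k2 k3 k4] := h h1; have [j1 j2 j3 j4] := h' h2.
rewrite k1 k2 j1 j2; split=> //.
- apply: (@rst_trans _ _ _ (interp s w1' ++ interp (tgt s w1) w2)).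
    have := tequiv_ctx (s := s) (B := [::]) (u := [::]) (v := [::]) _ _ k3.
    rewrite /= !cats0 /whisker !(eq_map (g := id)) ?map_id; last 2 first.
    + by case=> *; rewrite /= cats0.
    + by case=> *; rewrite /= cats0.
    apply; [exact/eqP | exact: ok_wf].
  have := tequiv_ctx (t := tgt (tgt s w1) w2) (A := [::]) (u := [::]) (v := [::]) _ _ j3.
  rewrite /= !cats0 /whisker !(eq_map (g := id)) ?map_id; last 2 first.
  + by case=> *; rewrite /= cats0.
  + by case=> *; rewrite /= cats0.
  by apply; [rewrite -k2; exact: ok_wf | exact/eqP].
- move=> m hm m'; apply/cout_cat/cout_cat => -[m1 c1 c2]; exists m1.
  + by rewrite -k4.
  + by rewrite -j4 //; apply: size_cout c1; rewrite hm; apply: ok_wsize.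
  + by rewrite k4.
  + by rewrite j4 //; move: c1; rewrite -k4 //; apply: size_cout; rewrite hm; apply: ok_wsize.
Qed.

Lemma refs_shift u s v w w' : wsize (size s) w -> wsize (size s) w' ->
  refs s w w' -> refs (u ++ s ++ v) (shift (size u) w) (shift (size u) w').
Proof.
move=> hw hw' [h]; split; rewrite (ok_shift u v hw) (ok_shift u v hw') => h1.
have [k1 k2 k3 k4] := h h1.
have [_ -> ->] := ok_shiftE u v h1; have [_ -> ->] := ok_shiftE u v k1.
rewrite k2; split=> //.
  have := tequiv_ctx (B := [::]) (A := [::]) (u := u) (v := v) _ _ k3.
  by rewrite /= !cats0; apply; exact/eqP.
move=> m; rewrite !size_cat => hm.
pose mu := take (size u) m; pose m0 := take (size s) (drop (size u) m).
pose mv := drop (size s) (drop (size u) m).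
have -> : m = mu ++ m0 ++ mv by rewrite !cat_take_drop.
have hu : size mu = size u by rewrite size_takel //; lia.
have h0 : size m0 = size s by rewrite size_takel // size_drop; lia.
rewrite -hu !cout_shift ?h0 // => m'.
apply/mapP/mapP => -[e]; [rewrite k4 //|rewrite -k4 //]; by exists e.
Qed.

End Equivalence.

(** * Moves as relations between words *)

Notation U n b := ((n, Kcup b) : gen).
Notation A n := ((n, Kcap) : gen).
Notation X n c := ((n, Kcross c) : gen).
Notation V n := ((n, Kcross Virtual) : gen).
Notation F n := ((n, Kcross (Real true)) : gen).

#[export] Instance refs_preorder (Y : xmove) s : PreOrder (refs Y s).
Proof. by split=> [w|w1 w2 w3]; [exact: refs_refl | exact: refs_trans]. Qed.

#[export] Instance ref_preorder (Y : xmove) : PreOrder (ref Y).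
Proof.
by split=> [w|w1 w2 w3 [h12] [h23]]; split=> s; [exact: refs_refl | exact: refs_trans (h12 s) (h23 s)].
Qed.

#[export] Instance ref_refs (Y : xmove) s : subrelation (ref Y) (refs Y s).
Proof. by move=> w w' []. Qed.

#[export] Instance ref_cat (Y : xmove) : Proper (ref Y ==> ref Y ==> ref Y) (@cat gen).
Proof. by move=> w1 w1' [h1] w2 w2' [h2]; split=> s; apply: refs_cat (h1 _) (h2 _). Qed.

#[export] Instance ref_cons (Y : xmove) : Proper (eq ==> ref Y ==> ref Y) (@cons gen).
Proof. by move=> g _ <- w w' h; apply: (ref_cat (reflexivity [:: g]) h). Qed.

#[export] Instance refs_catl (Y : xmove) s :
  Proper (refs Y s ==> ref Y ==> refs Y s) (@cat gen).
Proof. by move=> w1 w1' h1 w2 w2' [h2]; apply: refs_cat h1 (h2 _). Qed.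

Section Base.
Context (Y : xmove).
Notation ref := (ref Y).
Notation refs := (refs Y).

Lemma ref_rev w w' : ref w' w -> (forall s, ok s w -> ok s w') -> ref w w'.
Proof. by move=> [h] hok; split=> s; exact: refs_rev (h s) (hok s). Qed.

Lemma ref_rev_capless w w' : ref w' w ->
  capless (w ++ w') ->
  (forall k, wsize k w -> wsize k w') -> ref w w'.
Proof.
rewrite capless_cat => h /andP[h1 h2] hk; apply: ref_rev => // s.
by rewrite !ok_capless //; apply: hk.
Qed.

Lemma refs_of_move s w w' : move Y (interp s w) (interp s w') \/
    move Y (interp s w') (interp s w) ->
  ok s w' -> tgt s w' = tgt s w ->
  (forall m, size m = size s -> cout w m =i cout w' m) -> refs s w w'.
Proof.
move=> hM h' ht hc; split=> h; split=> //.
have step v v' : ok s v -> ok s v' -> tgt s v' = tgt s v ->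
    move Y (interp s v) (interp s v') ->
    tequiv Y s (tgt s v) (interp s v) (interp s v').
  move=> k k' kt kM; apply: rst_step.
  have whisker0 T : whisker [::] [::] T ++ [::] = T.
    by rewrite cats0 /whisker -[RHS]map_id; apply: eq_map => -[* /=]; rewrite cats0.
  exists [::] [::] [::] [::] (interp s v) (interp s v'); rewrite ?whisker0 //.
    exact: ok_wf.
  by rewrite -kt; apply: ok_wf.
by case: hM => hM; [|apply: rst_sym; rewrite -ht]; apply: step.
Qed.

Lemma refs_of_move_eq s w w' : move Y (interp s w) (interp s w') \/
    move Y (interp s w') (interp s w) ->
  ok s w' -> tgt s w' = tgt s w ->
  (forall m, size m = size s -> cout w m = cout w' m) -> refs s w w'.
Proof. by move=> h1 h2 h3 h4; apply: refs_of_move => // m /h4->. Qed.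

Lemma window (s : seq bool) n k : n + k <= size s ->
  exists u s0 v, [/\ s = u ++ s0 ++ v, size u = n & size s0 = k].
Proof.
move=> h; exists (take n s), (take k (drop n s)), (drop k (drop n s)).
by split; rewrite ?cat_take_drop ?size_takel ?size_drop //; lia.
Qed.

(** A source on which [shift n w] makes sense contains a window of [k] strands at position [n]; the
    remaining strands are only put beside it. *)
Lemma ref_shift k n w w' : (forall s, size s = k -> refs s w w') ->
  (forall j, wsize j (shift n w) -> n + k <= j) -> wsize k w -> wsize k w' ->
  ref (shift n w) (shift n w').
Proof.
move=> h hk h1 h2; split=> s; case hok: (ok s (shift n w)); last by split; rewrite hok.
have hs := ok_wsize hok.
have /window[u [s0 [v [-> hu h0]]]] : n + k <= size s by apply: hk; rewrite hs.
by rewrite -hu; apply: refs_shift; rewrite ?h0 //; apply: h.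
Qed.



Ltac colours := by move=> [|[] [|[] [|[] [|? ?]]]].
Ltac sizes := by move=> j; repeat (case: ifP => //= ?); lia.
Ltac shift_from k n w w' :=
  have := @ref_shift k n w w'; rewrite /shift /= !(addn0, addn1); apply=> //; last by sizes.

Lemma zigzag_r n a : ref [:: U n.+1 a; A n] [::].
Proof.
shift_from 1 n [:: U 1 a; A 0] ([::] : word).
(* On a source of the wrong orientation the word is not [ok], and [split] proves the relation
   vacuously. *)
case: a => -[|[] []] // _; try (by split); apply: refs_of_move_eq => //; try by colours.
- by left; constructor 1; apply: (Iso_zigzag_right false).
- by left; constructor 1; apply: (Iso_zigzag_right true).
Qed.

Lemma zigzag_l n a : ref [:: U n a; A n.+1] [::].
Proof.
shift_from 1 n [:: U 0 a; A 1] ([::] : word).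
case: a => -[|[] []] // _; try (by split); apply: refs_of_move_eq => //; try by colours.
- by left; constructor 1; apply: (Iso_zigzag_left true).
- by left; constructor 1; apply: (Iso_zigzag_left false).
Qed.

Lemma flipK c : flip (flip c) = c.
Proof. by case: c => //= b; rewrite negbK. Qed.

Lemma cap_slide n c : ref [:: X n c; A n.+1] [:: X n.+1 (flip c); A n].
Proof.
shift_from 3 n [:: X 0 c; A 1] [:: X 1 (flip c); A 0].
case=> [|x [|y [|z []]]] // _.
by case: x y z => [] [] [] //; apply: refs_of_move_eq => //; try colours;
  left; constructor 1; apply: (Iso_cap c).
Qed.

Lemma cap_slide_rev n c : ref [:: X n.+1 c; A n] [:: X n (flip c); A n.+1].
Proof.
shift_from 3 n [:: X 1 c; A 0] [:: X 0 (flip c); A 1].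
rewrite -{1}[c]flipK; case=> [|x [|y [|z []]]] // _.
by case: x y z => [] [] [] //; apply: refs_of_move_eq => //; try colours;
  right; constructor 1; apply: (Iso_cap (flip c)).
Qed.

Lemma cup_slide n c a : ref [:: U n.+1 a; X n c] [:: U n a; X n.+1 (flip c)].
Proof.
shift_from 1 n [:: U 1 a; X 0 c] [:: U 0 a; X 1 (flip c)].
by case=> [|x []] // _; apply: refs_of_move_eq => //; try colours; left; constructor 1; apply: (Iso_cup c).
Qed.

Lemma cup_slide_rev n c a : ref [:: U n a; X n.+1 c] [:: U n.+1 a; X n (flip c)].
Proof.
shift_from 1 n [:: U 0 a; X 1 c] [:: U 1 a; X 0 (flip c)].
rewrite -{1}[c]flipK.
by case=> [|x []] // _; apply: refs_of_move_eq => //; try colours;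
  right; constructor 1; apply: (Iso_cup (flip c)).
Qed.

Lemma reidemeister1_r n c a : ref [:: U n.+1 a; X n c; A n.+1] [::].
Proof.
shift_from 1 n [:: U 1 a; X 0 c; A 1] ([::] : word).
case: a => -[|[] []] // _; try (by split); apply: refs_of_move_eq => //; try (by colours);
  left; constructor 2; exact: R1_right.
Qed.

Lemma reidemeister1_l n c a : ref [:: U n a; X n.+1 c; A n] [::].
Proof.
shift_from 1 n [:: U 0 a; X 1 c; A 0] ([::] : word).
case: a => -[|[] []] // _; try (by split); apply: refs_of_move_eq => //; try by colours.
- by left; constructor 2; apply: (R1_left c false).
- by left; constructor 2; apply: (R1_left c true).
Qed.

Lemma reidemeister2 n c : ref [:: X n c; X n (flip c)] [::].
Proof.
shift_from 2 n [:: X 0 c; X 0 (flip c)] ([::] : word).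
by case=> [|x [|y []]] // _; apply: refs_of_move_eq => //; try colours; left; constructor 2; apply: R2.
Qed.

Lemma reidemeister3 n c12 c13 c23 : R3_crossings c12 c13 c23 ->
  ref [:: X n c12; X n.+1 c13; X n c23] [:: X n.+1 c23; X n c13; X n.+1 c12].
Proof.
move=> h; shift_from 3 n [:: X 0 c12; X 1 c13; X 0 c23] [:: X 1 c23; X 0 c13; X 1 c12].
by case=> [|x [|y [|z []]]] // _; apply: refs_of_move_eq => //; try colours; left; constructor 2; apply: R3.
Qed.

Lemma reidemeister3_rev n c12 c13 c23 : R3_crossings c12 c13 c23 ->
  ref [:: X n.+1 c23; X n c13; X n.+1 c12] [:: X n c12; X n.+1 c13; X n c23].
Proof.
move=> h; shift_from 3 n [:: X 1 c23; X 0 c13; X 1 c12] [:: X 0 c12; X 1 c13; X 0 c23].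
by case=> [|x [|y [|z []]]] // _; apply: refs_of_move_eq => //; try colours; right; constructor 2; apply: R3.
Qed.


Lemma gcout_cat K (u e v : seq bool) : size e = ksrc K ->
  gcout (size u, K) (u ++ e ++ v) = [seq u ++ e' ++ v | e' <- kcout K e].
Proof.
move=> h; rewrite /gcout /gmid /= take_size_cat // [_ + _]addnC -drop_drop.
by rewrite !drop_size_cat // take_size_cat.
Qed.

(** This is the generator [Iso_exchange], with the events at the two ends of the source. Colourings
    are compared by cutting them into the parts below [e], below [m] and below [f]. *)
Lemma exch_local e m f : let s := event_src e ++ m ++ event_src f in
  let w := [:: (0, event_kind e); (ktgt (event_kind e) + size m, event_kind f)] in
  let w' := [:: (ksrc (event_kind e) + size m, event_kind f); (0, event_kind e)] in
  refs s w w' /\ refs s w' w.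
Proof.
move=> s w w'.
have [a1 a2 a3] := glayer_cat [::] e (m ++ event_src f).
have [b1 b2 b3] := glayer_cat (event_tgt e ++ m) f [::].
have [c1 c2 c3] := glayer_cat (event_src e ++ m) f [::].
have [d1 d2 d3] := glayer_cat [::] e (m ++ event_tgt f).
rewrite !(cats0, size_cat, size_event_src, size_event_tgt, cat0s) -?catA /= in
  a1 a2 a3 b1 b2 b3 c1 c2 c3 d1 d2 d3.
have hc q : size q = size s -> cout w q =i cout w' q.
  rewrite !size_cat !size_event_src => hq p.
  have [q1 [q2 [q3 [-> h1 h2 h3]]]] : exists q1 q2 q3, [/\ q = q1 ++ q2 ++ q3,
      size q1 = ksrc (event_kind e), size q2 = size m & size q3 = ksrc (event_kind f)].
    exists (take (ksrc (event_kind e)) q), (take (size m) (drop (ksrc (event_kind e)) q)),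
      (drop (size m) (drop (ksrc (event_kind e)) q)).
    by split; rewrite ?cat_take_drop ?size_takel ?size_drop //; lia.
  have ge r t : size r = ksrc (event_kind e) ->
      gcout (0, event_kind e) (r ++ t) = [seq r' ++ t | r' <- kcout (event_kind e) r].
    exact: (@gcout_cat _ [::]).
  have gf r t j : size t = ksrc (event_kind f) -> j = size r ->
      gcout (j, event_kind f) (r ++ t) = [seq r ++ t' | t' <- kcout (event_kind f) t].
    move=> ht ->; have := @gcout_cat _ r t [::] ht; rewrite cats0 => ->.
    by apply: eq_map => t'; rewrite cats0.
  rewrite /w /w' /= ge // catA gf //; last by rewrite size_cat h1 h2.
  apply/idP/idP => /flatten_mapP[_ /mapP[r hr ->]].
  - rewrite catA gf // ?size_cat ?h2 ?(size_kcout hr) // => /flatten_mapP[_ /mapP[t ht ->]].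
    rewrite inE => /eqP->; apply/flatten_mapP; exists ((q1 ++ q2) ++ t); first exact: map_f.
    rewrite /= -(catA q1) ge //; apply/flatten_mapP; exists (r ++ q2 ++ t).
      exact: (map_f (fun r => r ++ q2 ++ t)).
    by rewrite catA inE.
  - rewrite -(catA q1) ge // => /flatten_mapP[_ /mapP[t ht ->]].
    rewrite inE => /eqP->; apply/flatten_mapP; exists (t ++ q2 ++ q3).
      exact: (map_f (fun t => t ++ q2 ++ q3)).
    rewrite /= (catA t q2 q3) gf // ?size_cat ?h2 ?(size_kcout ht) //; apply/flatten_mapP.
    by exists ((t ++ q2) ++ r); [exact: map_f | rewrite -catA inE].
have okw : ok s w by rewrite /s /w /= a1 a3 b1.
have okw' : ok s w' by rewrite /s /w' /= c1 c3 d1.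
have tw : tgt s w' = tgt s w by rewrite /s /w /w' /= a3 b3 c3 d3.
have mv : move Y (interp s w) (interp s w').
  by rewrite /s /w /w' /= a3 a2 b2 c3 c2 d2; constructor 1; constructor.
by split; apply: refs_of_move => //; [left | right | move=> q hq p; rewrite hc].
Qed.

Lemma exch_window u e m f v : let s := u ++ event_src e ++ m ++ event_src f ++ v in
  let w := [:: (size u, event_kind e);
               (size u + ktgt (event_kind e) + size m, event_kind f)] in
  let w' := [:: (size u + ksrc (event_kind e) + size m, event_kind f);
                (size u, event_kind e)] in
  refs s w w' /\ refs s w' w.
Proof.
have [h1 h2] := exch_local e m f.
have -> : u ++ event_src e ++ m ++ event_src f ++ v =
  u ++ (event_src e ++ m ++ event_src f) ++ v by rewrite -!catA.
move=> s w w'; set s0 := _ ++ _ in h1 h2 *; set w0 := [:: _; _] in h1 h2.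
set w0' := [:: _; _] in h1 h2.
have -> : w = shift (size u) w0 by rewrite /w /w0 /shift /= addn0 addnA.
have -> : w' = shift (size u) w0' by rewrite /w' /w0' /shift /= addn0 addnA.
have k : wsize (size s0) w0.
  by rewrite /= !size_cat !size_event_src; do 2?rewrite ifT //; lia.
have k' : wsize (size s0) w0'.
  by rewrite /= !size_cat !size_event_src; do 2?rewrite ifT //; lia.
by split; apply: refs_shift.
Qed.

Lemma exch n m K L : n + ktgt K <= m ->
  ref [:: (n, K); (m, L)] [:: (m - ktgt K + ksrc K, L); (n, K)].
Proof.
move=> hnm; split=> s; case hok: (ok s [:: (n, K); (m, L)]); last by split; rewrite hok.
have /= /andP[h1 /andP[+ _]] := hok; clear hok.
have [u [e [v [Es [En EK] _ ->]]]] := gok_split h1.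
move=> /gok_split[u' [f [v' [Ev [Em EL] _ _]]]].
(* [j] consists of the strands between the two events. *)
have [j [Ej Eu]] : exists j, v = j ++ event_src f ++ v' /\ u' = (u ++ event_tgt e) ++ j.
  exists (drop (size (u ++ event_tgt e)) u'); rewrite catA in Ev.
  have hk : size (u ++ event_tgt e) <= size u'.
    by rewrite size_cat size_event_tgt -EK -En -Em.
  have E1 : u ++ event_tgt e = take (size (u ++ event_tgt e)) u'.
    by rewrite -(takel_cat (event_src f ++ v') hk) -Ev take_size_cat.
  split; last by rewrite {1}E1 cat_take_drop.
  have := congr1 (drop (size (u ++ event_tgt e))) Ev.
  by rewrite drop_size_cat // drop_cat; case: ltnP => // h -> /=; rewrite (drop_oversize h) (_ : _ - _ = 0) ?drop0 //; lia.
have [h _] := exch_window u e j f v'; move: h => /=; rewrite -Ej -Es -EK -EL -En.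
have Em' : m = n + ktgt K + size j by rewrite Em Eu !size_cat size_event_tgt -EK -En.
have -> : m - ktgt K + ksrc K = n + ksrc K + size j by lia.
by rewrite -Em'.
Qed.
End Base.

(** * Passing events across words of crossings, and virtual detours *)

Section Words.
Context (Y : xmove).
Notation ref := (ref Y).
Notation refs := (refs Y).

Lemma exch_rev n m K L : n + ksrc K <= m ->
  ref [:: (m, L); (n, K)] [:: (n, K); (m - ksrc K + ktgt K, L)].
Proof.
move=> hnm; split=> s; case hok: (ok s [:: (m, L); (n, K)]); last by split; rewrite hok.
have /= /andP[h1 /andP[+ _]] := hok; clear hok.
have [u' [f [v' [Es [Em EL] _ ->]]]] := gok_split h1.
move=> /gok_split[u [e [v [Ev [En EK] _ _]]]].
have [j Eu] : exists j, u' = u ++ event_src e ++ j.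
  exists (drop (size (u ++ event_src e)) u'); move: Ev; rewrite (catA u (event_src e)) => Ev.
  have hk : size (u ++ event_src e) <= size u'.
    by rewrite size_cat size_event_src -EK -En -Em.
  have E1 : u ++ event_src e = take (size (u ++ event_src e)) u'.
    by rewrite -(takel_cat (event_tgt f ++ v') hk) Ev take_size_cat.
  by rewrite catA {1}E1 cat_take_drop.
have [_] := exch_window Y u e j f v'; rewrite /= -EK -EL -En.
have <- : m = n + ksrc K + size j by rewrite Em Eu !size_cat size_event_src -EK; lia.
have <- : m - ksrc K + ktgt K = n + ktgt K + size j.
  by rewrite Em Eu !size_cat size_event_src -EK; lia.
by rewrite !catA -(catA u) -Eu -catA -Es.
Qed.

Lemma ref_app r w w' : ref w w' -> ref (w ++ r) (w' ++ r).
Proof. by move=> h; rewrite -> h; reflexivity. Qed.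

Lemma exch_c n m K L m' r : n + ktgt K <= m -> m' = m - ktgt K + ksrc K ->
  ref ((n, K) :: (m, L) :: r) ((m', L) :: (n, K) :: r).
Proof. by move=> h ->; exact (ref_app r (exch Y L h)). Qed.

Lemma exch_rev_c n m K L m' r : n + ksrc K <= m -> m' = m - ksrc K + ktgt K ->
  ref ((m, L) :: (n, K) :: r) ((n, K) :: (m', L) :: r).
Proof. by move=> h ->; exact (ref_app r (exch_rev L h)). Qed.

(** A word of crossings confined to the strands [lo] to [hi - 1], past which any event outside this
    range can slide. *)
Definition inX lo hi (w : word) :=
  all (fun g : gen => if g.2 is Kcross _ then (lo <= g.1) && (g.1.+2 <= hi) else false) w.

Lemma inX_cat lo hi w w' : inX lo hi (w ++ w') = inX lo hi w && inX lo hi w'.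
Proof. exact: all_cat. Qed.

Lemma pass_left lo hi w n K : inX lo hi w -> hi <= n ->
  ref (w ++ [:: (n, K)]) ((n, K) :: w).
Proof.
move=> + hn; elim: w => [_|[m [b||c]] w IH] //=; first by reflexivity.
move=> /andP[/andP[_ hm] /IH h].
by rewrite -> h, (@exch_c _ _ _ _ n); [reflexivity | simpl; lia..].
Qed.

Lemma pass_left_rev lo hi w n K : inX lo hi w -> hi <= n ->
  ref ((n, K) :: w) (w ++ [:: (n, K)]).
Proof.
move=> + hn; elim: w => [_|[m [b||c]] w IH] //=; first by reflexivity.
move=> /andP[/andP[_ hm] /IH h].
by rewrite -> (@exch_rev_c _ _ _ _ n), h; [reflexivity | simpl; lia..].
Qed.

Lemma pass_right lo hi w n K : inX lo hi w -> n <= lo ->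
  ref ((n, K) :: shift (ktgt K) w) (shift (ksrc K) w ++ [:: (n, K)]).
Proof.
move=> + hn; elim: w => [_|[m [b||c]] w IH] //=; first by reflexivity.
move=> /andP[/andP[hm _] /IH h].
by rewrite -> (@exch_c n _ K _ (ksrc K + m)), h; [reflexivity | simpl; lia..].
Qed.

Lemma pass_right_rev lo hi w n K : inX lo hi w -> n <= lo ->
  ref (shift (ksrc K) w ++ [:: (n, K)]) ((n, K) :: shift (ktgt K) w).
Proof.
move=> + hn; elim: w => [_|[m [b||c]] w IH] //=; first by reflexivity.
move=> /andP[/andP[hm _] /IH h].
by rewrite -> h, (@exch_rev_c n _ K _ (ktgt K + m)); [reflexivity | simpl; lia..].
Qed.


Lemma pass_left_c lo hi w n K r : inX lo hi w -> hi <= n ->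
  ref (w ++ (n, K) :: r) ((n, K) :: w ++ r).
Proof. by move=> hw h; have := ref_app r (pass_left K hw h); rewrite -catA. Qed.
Lemma pass_left_rev_c lo hi w n K r : inX lo hi w -> hi <= n ->
  ref ((n, K) :: w ++ r) (w ++ (n, K) :: r).
Proof. by move=> hw h; have := ref_app r (pass_left_rev K hw h); rewrite -catA. Qed.

Lemma inX_unshift k lo hi w : inX lo hi w -> k <= lo ->
  exists w', w = shift k w' /\ inX (lo - k) (hi - k) w'.
Proof.
move=> + hk; elim: w => [|[n [b||c]] w IH] //=; first by exists [::].
case/andP=> h /IH[w' [-> hw']]; exists ((n - k, Kcross c) :: w'); rewrite /= hw' subnKC; last lia.
by split=> //; rewrite andbT; lia.
Qed.

Lemma pass_cross lo hi w n c : inX lo hi w -> n.+2 <= lo ->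
  ref (X n c :: w) (w ++ [:: X n c]) /\ ref (w ++ [:: X n c]) (X n c :: w).
Proof.
move=> hw hn; have [|w' [-> hw']] := @inX_unshift 2 _ _ _ hw; first lia.
have h : n <= lo - 2 by lia.
by split; [exact (pass_right (Kcross c) hw' h) | exact (pass_right_rev (Kcross c) hw' h)].
Qed.

(** The strand at position [i] travels to the right past [k] strands through virtual crossings;
    [mvl] is the way back. *)
Definition mvr i k : word := [seq V j | j <- iota i k].
Definition mvl i k : word := rev (mvr i k).

Lemma mvrD i k l : mvr i (k + l) = mvr i k ++ mvr (i + k) l.
Proof. by rewrite /mvr iotaD map_cat. Qed.
Lemma mvrS i k : mvr i k.+1 = mvr i k ++ [:: V (i + k)].
Proof. by rewrite -addn1 mvrD. Qed.
Lemma mvrS' i k : mvr i k.+1 = V i :: mvr i.+1 k.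
Proof. by []. Qed.
Lemma mvlS i k : mvl i k.+1 = V (i + k) :: mvl i k.
Proof. by rewrite /mvl mvrS rev_cat. Qed.
Lemma mvlS' i k : mvl i k.+1 = mvl i.+1 k ++ [:: V i].
Proof. by rewrite /mvl /= rev_cons -cats1. Qed.

Lemma shift_mvr l i k : shift l (mvr i k) = mvr (l + i) k.
Proof. by rewrite /shift /mvr iotaDl -!map_comp. Qed.
Lemma shift_mvl l i k : shift l (mvl i k) = mvl (l + i) k.
Proof. by rewrite /mvl -shift_mvr /shift map_rev. Qed.

Lemma inX_mvr i k lo hi : lo <= i -> i + k < hi -> inX lo hi (mvr i k).
Proof.
move=> h1 h2; rewrite /inX /mvr all_map; apply/allP=> j.
by rewrite mem_iota /= => hj; lia.
Qed.
Lemma inX_mvl i k lo hi : lo <= i -> i + k < hi -> inX lo hi (mvl i k).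
Proof. by move=> h1 h2; rewrite /inX all_rev; apply: inX_mvr. Qed.

Lemma wsize_cat k w w' : wsize k (w ++ w') = obind (fun j => wsize j w') (wsize k w).
Proof. by elim: w k => //= g w IH k; case: ifP. Qed.

Lemma wsize_inX lo hi k w : inX lo hi w -> hi <= k -> wsize k w = Some k.
Proof.
move=> + hk; elim: w => [|[n [b||c]] w IH] //= /andP[hn /IH h].
by rewrite ifT ?subnK //; lia.
Qed.

Lemma cancel n c r : ref (X n c :: X n (flip c) :: r) r.
Proof. exact (ref_app r (reidemeister2 Y n c)). Qed.

Lemma cancelV n r : ref (V n :: V n :: r) r.
Proof. exact: cancel. Qed.

Lemma mvr_mvl i k : ref (mvr i k ++ mvl i k) [::].
Proof.
elim: k => [|k IH]; first by reflexivity.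
by rewrite mvrS mvlS -catA /=; rewrite -> cancelV.
Qed.
Lemma mvl_mvr i k : ref (mvl i k ++ mvr i k) [::].
Proof.
elim: k i => [|k IH] i; first by reflexivity.
by rewrite mvlS' mvrS' -catA /=; rewrite -> cancelV.
Qed.

Lemma R3_crossingsV c : [/\ R3_crossings Virtual Virtual c, R3_crossings c Virtual Virtual
  & R3_crossings Virtual c Virtual].
Proof. by case: c. Qed.

(** Move III in which one strand has two virtual crossings, so that the third crossing is arbitrary;
    this and the next three lemmas are its forms for the two directions of travel. *)
Lemma detour n c r :
  ref (X n.+1 c :: V n :: V n.+1 :: r) (V n :: V n.+1 :: X n c :: r).
Proof. by have [h _ _] := R3_crossingsV c; exact (ref_app r (reidemeister3_rev Y n h)). Qed.
Lemma detour_rev n c r :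
  ref (V n :: V n.+1 :: X n c :: r) (X n.+1 c :: V n :: V n.+1 :: r).
Proof. by have [h _ _] := R3_crossingsV c; exact (ref_app r (reidemeister3 Y n h)). Qed.
Lemma detourl n c r :
  ref (X n c :: V n.+1 :: V n :: r) (V n.+1 :: V n :: X n.+1 c :: r).
Proof. by have [_ h _] := R3_crossingsV c; exact (ref_app r (reidemeister3 Y n h)). Qed.
Lemma detourl_rev n c r :
  ref (V n.+1 :: V n :: X n.+1 c :: r) (X n c :: V n.+1 :: V n :: r).
Proof. by have [_ h _] := R3_crossingsV c; exact (ref_app r (reidemeister3_rev Y n h)). Qed.

Lemma mvr_cross n c i k : i < n -> n < i + k ->
  ref (X n c :: mvr i k) (mvr i k ++ [:: X n.-1 c]) /\
  ref (mvr i k ++ [:: X n.-1 c]) (X n c :: mvr i k).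
Proof.
case: n => // n /= hi hk.
have -> : k = (n - i) + (2 + (k - (n - i) - 2)) by lia.
rewrite mvrD (_ : i + (n - i) = n); last lia.
rewrite mvrD; set w := mvr i _; set w' := mvr (n + 2) _.
have hw : inX i n.+1 w by apply: inX_mvr; lia.
have hw' : inX n.+2 (i + k).+2 w' by apply: inX_mvr; lia.
have [h1 h2] := pass_cross c hw' (leqnn _).
split; rewrite -?catA /=.
- by rewrite -> (pass_left_rev_c (Kcross c) _ hw), detour, h1; [reflexivity | lia].
- by rewrite -> h2, detour_rev, (pass_left_c (Kcross c) _ hw); [reflexivity | lia].
Qed.
End Words.

(** * Kinks and rotated crossings *)

Section Crossings.
Context (Y : xmove).
Notation ref := (ref Y).
Notation refs := (refs Y).

Lemma refs_app s w r w' : refs s w w' -> refs s (w ++ r) (w' ++ r).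
Proof. by move=> h; apply: refs_cat h _; exact: refs_refl. Qed.

Lemma refs_pre s w r r' : refs (tgt s w) r r' -> refs s (w ++ r) (w ++ r').
Proof. by move=> h; apply: refs_cat h; exact: refs_refl. Qed.

Lemma refs_window u v s w w' : refs s w w' -> wsize (size s) w -> wsize (size s) w' ->
  refs (u ++ s ++ v) (shift (size u) w) (shift (size u) w').
Proof. by move=> h h1 h2; exact: refs_shift. Qed.

(** A zigzag inserted above the crossing makes it a kink on a single strand, removed by move I. The
    two legs have exchanged sides, hence [~~ a]. *)
Lemma kink_cup n a c : ref [:: U n a; X n c] [:: U n (~~ a)].
Proof.
have h : refs [::] [:: U 0 a; X 0 c] [:: U 0 (~~ a)].
  transitivity [:: U 0 a; X 0 c; U 0 (~~ a); A 1].
    apply: (@refs_pre _ [:: U 0 a; X 0 c] [::]); apply: refs_rev => [|_].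
      exact (refP (zigzag_l Y 0 (~~ a)) _).
    by case: (a).
  rewrite -> (@exch_rev_c _ 0 0 (Kcup (~~ a)) (Kcross c) 2) => //.
  rewrite -> (@exch_rev_c _ 0 0 (Kcup (~~ a)) (Kcup a) 2) => //.
  rewrite -> cap_slide_rev, reidemeister1_r; reflexivity.
have := @ref_shift Y 0 n [:: U 0 a; X 0 c] [:: U 0 (~~ a)].
rewrite /shift /= !addn0; apply=> //; first by case.
by move=> j; case: ifP => //= ?; lia.
Qed.

Lemma kink_cap n c : ref [:: X n c; A n] [:: A n].
Proof.
have h y : refs [:: y; ~~ y] [:: X 0 c; A 0] [:: A 0].
  transitivity [:: U 1 (~~ y); A 0; X 0 c; A 0].
    apply: (@refs_cat _ _ [::] [:: U 1 (~~ y); A 0]); last exact: refs_refl.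
    apply: refs_rev => [|_]; first exact (refP (zigzag_r Y 0 (~~ y)) _).
    by case: (y).
  rewrite -> (@exch_c _ 0 0 Kcap (Kcross c) 2) => //.
  rewrite -> (@exch_c _ 0 0 Kcap Kcap 2) => //.
  have e : ref [:: U 1 (~~ y); X 2 c; A 2; A 0] [:: A 0].
    transitivity [:: U 2 (~~ y); X 1 (flip c); A 2; A 0].
      exact (ref_app [:: A 2; A 0] (cup_slide_rev Y 1 c (~~ y))).
    exact (ref_app [:: A 0] (reidemeister1_r Y 1 (flip c) (~~ y))).
  by rewrite -> e; reflexivity.
have := @ref_shift Y 2 n [:: X 0 c; A 0] [:: A 0].
rewrite /shift /= !addn0; apply=> //.
  case=> [|x [|y []]] // _; case E: (y == ~~ x); first by rewrite (eqP E).
  by split; case: x y E => [] [].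
by move=> j; case: ifP => //= ?; lia.
Qed.

(** Bending the second strand by a zigzag makes it run through the crossing in the other vertical
    direction: a crossing of orientations [(y, z)] becomes one of orientations [(~~ z, y)].
    Iterating this visits all four pairs. *)
Lemma quarter_turn y z c :
  refs [:: y; z] [:: X 0 c] [:: U 0 z; X 1 (flip c); A 2].
Proof.
transitivity [:: U 1 z; A 2; X 0 c].
  apply: (@refs_cat _ _ [::] [:: U 1 z; A 2]); last exact: refs_refl.
  apply: refs_rev => [|_]; first exact (refP (zigzag_l Y 1 z) _).
  by case: (y) (z) => [] [].
rewrite -> (@exch_rev_c _ 0 2 (Kcross c) Kcap 2) => //.
exact (refP (ref_app [:: A 2] (cup_slide Y 0 c z)) _).
Qed.

(* The added arc joins the two strands that meet at the left vertex of the square;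
   this vertex becomes a kink, and the three others form a triangle. *)
Lemma square_to_triangle c b : ref [:: U 0 b; X 2 c; X 1 c; X 3 c; X 2 c; A 0]
  [:: X 0 c; X 1 c; X 0 c].
Proof.
rewrite -> (@exch_rev_c _ 0 2 Kcap (Kcross c) 0) => //.
rewrite -> (@exch_rev_c _ 0 3 Kcap (Kcross c) 1) => //.
rewrite -> (@exch_c _ 0 2 (Kcup b) (Kcross c) 0) => //.
rewrite -> (ref_app [:: X 1 c; X 0 c] (reidemeister1_l Y 0 c b)); reflexivity.
Qed.

End Crossings.

(** * Crossing change and flat triangles *)

(* The orientation [c] for which the move makes a triangle with strands of
   orientations [b], [c], [b] virtual. *)
Definition midstrand (Y : xmove) (b : bool) : bool :=
  match Y with vDelta_wedge | vSharp => b | _ => ~~ b end.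


(** The middle crossing [o] depends on the move: a cyclic triangle needs it opposite to the other
    two, while the crossings of a square all have the same type. *)
Lemma x_triangle (Y : xmove) : exists o, forall b, refs Y [:: b; midstrand Y b; b]
  [:: X 0 (Real true); X 1 (Real o); X 0 (Real true)] [:: V 0; V 1; V 0].
Proof.
have via_square a b : (forall o, x_move Y (square (Real o) b a b a) (square Virtual b a b a)) ->
    refs Y [:: a; b; a] [:: F 0; F 1; F 0] [:: V 0; V 1; V 0].
  (* The added minimum supplies the fourth strand of the square; its right leg must have orientation
     [b]. *)
  move=> hM; transitivity [:: U 0 (~~ b); F 2; F 1; F 3; F 2; A 0].
    apply: refs_rev; first exact (refP (square_to_triangle Y (Real true) (~~ b)) _).
    by case: (a) (b) => [] [].
  rewrite <- (square_to_triangle Y Virtual (~~ b)).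
  apply: (@refs_pre Y [:: a; b; a] [:: U 0 (~~ b)]).
  rewrite -[[:: F 2; F 1; F 3; F 2; A 0]]/([:: F 2; F 1; F 3; F 2] ++ [:: A 0]).
  rewrite -[[:: V 2; V 1; V 3; V 2; A 0]]/([:: V 2; V 1; V 3; V 2] ++ [:: A 0]).
  apply: refs_app; rewrite (_ : tgt _ _ = [:: ~~ b; b; a; b; a]); last first.
    by rewrite /= /gtgt /layer_tgt /= negbK.
  apply: (@refs_shift Y [:: ~~ b] [:: b; a; b; a] [::] [:: F 1; F 0; F 2; F 1] [:: V 1; V 0; V 2; V 1]) => //.
  apply: refs_of_move_eq => //; by left; constructor 3; exact: hM.
have via_triangle a b c : x_move Y (triangle_r (Real true) (Real false) (Real true) a b c)
    (triangle_r Virtual Virtual Virtual a b c) ->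
    refs Y [:: a; b; c] [:: F 0; X 1 (Real false); F 0] [:: V 0; V 1; V 0].
  move=> hM; apply: refs_of_move_eq => //; by left; constructor 3.
case: Y via_square via_triangle => via_square via_triangle.
- exists false => b; apply: via_triangle.
  by case: b; [apply: (@X_triangle_r true false true true true true)
    | apply: (@X_triangle_r true false true false false false)].
- exists false => b; apply: via_triangle.
  by case: b; [apply: (@X_triangle_r true false true true false true)
    | apply: (@X_triangle_r true false true false true false)].
- by exists true => b; apply: via_square => o; apply: X_sharp.
- exists true => b; apply: via_square => o.
  by case: b; [apply: (X_pass o false false) | apply: (X_pass o true true)].
Qed.

Section CrossingChange.
Context (Y : xmove).
Notation ref := (ref Y).
Notation refs := (refs Y).

(* The outer strands of the triangle are joined at their crossing [c13], which
   becomes a kink. *)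
Lemma join_right a c12 c13 c23 :
  ref [:: U 2 a; X 0 c12; X 1 c13; X 0 c23; A 2] [:: X 0 c12; X 0 c23].
Proof.
rewrite -> (@exch_c _ 0 2 (Kcross c23) Kcap 2) => //.
rewrite -> (@exch_rev_c _ 0 2 (Kcross c12) (Kcup a) 2) => //.
rewrite -> (ref_app [:: X 0 c23] (reidemeister1_r Y 1 c13 a)); reflexivity.
Qed.

(** In both the real and the virtual triangle, joining the outer strands leaves the crossings 12 and
    23, now between the same two strands. The virtual ones cancel, so the real ones are trivial
    although they form a clasp. *)
Lemma double_crossing b :
  refs [:: b; midstrand Y b] [:: F 0; F 0] [::].
Proof.
have [o h] := x_triangle Y.
transitivity [:: U 2 b; F 0; X 1 (Real o); F 0; A 2].
  apply: refs_rev => [|_]; first exact (refP (join_right b _ _ _) _).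
  by case: b (midstrand Y b) => [] [].
transitivity [:: U 2 b; V 0; V 1; V 0; A 2].
  apply: (@refs_pre Y _ [:: U 2 b]); rewrite (_ : tgt _ _ = [:: b; midstrand Y b; b; ~~ b]) //.
  apply: (@refs_app Y _ [:: F 0; X 1 (Real o); F 0] [:: A 2] [:: V 0; V 1; V 0]).
  exact (refs_window [::] [:: ~~ b] (h b) isT isT).
rewrite -> join_right, cancelV; reflexivity.
Qed.

Definition exchangeable y z :=
  forall p q, refs [:: y; z] [:: X 0 (Real p)] [:: X 0 (Real q)].

(** By move II the inverse of [F 0] is the opposite crossing, and by [double_crossing] it is [F 0]
    itself. *)
Lemma exchangeable_mid b : exchangeable b (midstrand Y b).
Proof.
set c := midstrand Y b.
have h : refs [:: b; c] [:: F 0] [:: X 0 (Real false)].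
  transitivity [:: F 0; F 0; X 0 (Real false)].
    apply: (@refs_pre Y _ [:: F 0] [::]); apply: refs_rev => //.
    exact (refP (reidemeister2 Y 0 (Real true)) _).
  exact: (refs_app [:: X 0 (Real false)] (double_crossing b)).
by case=> [] []; [reflexivity | exact: h | apply: refs_rev h _ | reflexivity].
Qed.

Lemma exchangeable_turn y z : exchangeable (~~ z) y -> exchangeable y z.
Proof.
move=> h p q; transitivity [:: U 0 z; X 1 (Real (~~ p)); A 2].
  exact: quarter_turn.
transitivity [:: U 0 z; X 1 (Real (~~ q)); A 2].
  apply: (@refs_pre Y _ [:: U 0 z]); rewrite (_ : tgt _ _ = [:: z; ~~ z; y; z]) //.
  apply: (@refs_app Y _ [:: X 1 (Real (~~ p))] [:: A 2] [:: X 1 (Real (~~ q))]).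
  exact (refs_window [:: z] [:: z] (h (~~ p) (~~ q)) isT isT).
apply: refs_rev => [|_]; first exact: (quarter_turn Y y z (Real q)).
by case: y z {h} => [] [].
Qed.

(** The pairs [(b, midstrand Y b)], for both [b], and one quarter turn cover all orientations. From
    here on every real crossing can be written [F]. *)
Lemma crossing_change n p q : ref [:: X n (Real p)] [:: X n (Real q)].
Proof.
have h y z : exchangeable y z.
  have := exchangeable_mid; rewrite /midstrand; case: (Y) => hm;
  by (case: y z => [] []; try exact: (hm true); try exact: (hm false); apply: exchangeable_turn; try exact: (hm true); exact: (hm false)).
have := @ref_shift Y 2 n [:: X 0 (Real p)] [:: X 0 (Real q)].
rewrite /shift /= !addn0; apply=> //; first by case=> [|y [|z []]] // _; apply: h.
by move=> j; case: ifP => //= ?; lia.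
Qed.

Lemma cancelF n r : ref (F n :: F n :: r) r.
Proof.
rewrite -> (ref_app (F n :: r) (crossing_change n true false)).
exact: (@cancel Y n (Real false)).
Qed.

Lemma flat_cup_slide_rev n a r : ref (U n a :: F n.+1 :: r) (U n.+1 a :: F n :: r).
Proof.
rewrite -> (ref_app r (cup_slide_rev Y n (Real true) a)) => /=.
rewrite -> (ref_app r (crossing_change n false true)); reflexivity.
Qed.

Lemma flat_R3_rev n r : ref (F n.+1 :: F n :: F n.+1 :: r) (F n :: F n.+1 :: F n :: r).
Proof. exact (ref_app r (@reidemeister3_rev Y n (Real true) (Real true) (Real true) isT)). Qed.

Lemma flat_triangle b : refs [:: b; midstrand Y b; b] [:: F 0; F 1; F 0] [:: V 0; V 1; V 0].
Proof.
have [o h] := x_triangle Y.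
rewrite -> (ref_app [:: F 0] (crossing_change 1 true o) : ref [:: F 1; F 0] _).
exact: h.
Qed.

End CrossingChange.

(** * Beads *)

Section Beads.
Context (Y : xmove).
Notation ref := (ref Y).
Notation refs := (refs Y).

Lemma mvr_split i n k : i <= n -> n <= i + k ->
  mvr i k.+2 = mvr i (n - i) ++ V n :: V n.+1 :: mvr n.+2 (i + k - n).
Proof.
move=> h1 h2; have -> : k.+2 = (n - i) + (i + k - n).+2 by lia.
by rewrite mvrD subnKC.
Qed.
Lemma mvl_split i n k : i <= n -> n <= i + k ->
  mvl i k.+2 = mvl n.+2 (i + k - n) ++ V n.+1 :: V n :: mvl i (n - i).
Proof.
by move=> h1 h2; rewrite /mvl (mvr_split h1 h2) rev_cat !rev_cons -!cats1 -!catA.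
Qed.
Lemma mvr_join i n k : i <= n -> n <= i + k ->
  mvr i k = mvr i (n - i) ++ mvr n (i + k - n).
Proof.
move=> h1 h2; have -> : k = (n - i) + (i + k - n) by lia.
by rewrite mvrD subnKC //; congr (_ ++ mvr _ _); lia.
Qed.
Lemma mvl_join i n k : i <= n -> n <= i + k ->
  mvl i k = mvl n (i + k - n) ++ mvl i (n - i).
Proof. by move=> h1 h2; rewrite /mvl -rev_cat -mvr_join. Qed.

Lemma pass_cross_c lo hi w n c r : inX lo hi w -> n.+2 <= lo ->
  ref (X n c :: w ++ r) (w ++ X n c :: r) /\ ref (w ++ X n c :: r) (X n c :: w ++ r).
Proof.
move=> hw hn; have [h1 h2] := pass_cross Y c hw hn.
by split; [have := ref_app r h1 | have := ref_app r h2]; rewrite -catA.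
Qed.

Lemma pass_cup lo hi w n a r : inX lo hi w -> n <= lo ->
  ref (U n a :: shift 2 w ++ r) (w ++ U n a :: r) /\
  ref (w ++ U n a :: r) (U n a :: shift 2 w ++ r).
Proof.
move=> hw hn; have h1 := pass_right Y (Kcup a) hw hn; have h2 := pass_right_rev Y (Kcup a) hw hn.
split; [have := ref_app r h1 | have := ref_app r h2]; by rewrite /= shift0 -catA.
Qed.

Lemma pass_cap lo hi w n r : inX lo hi w -> n <= lo ->
  ref (shift 2 w ++ A n :: r) (A n :: w ++ r).
Proof.
move=> hw hn; have := ref_app r (pass_right_rev Y Kcap hw hn).
by rewrite /= shift0 -catA.
Qed.

Lemma cup_slide_c n c a r :
  ref (U n.+1 a :: X n c :: r) (U n a :: X n.+1 (flip c) :: r).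
Proof. exact (ref_app r (cup_slide Y n c a)). Qed.
Lemma cup_slide_rev_c n c a r :
  ref (U n a :: X n.+1 c :: r) (U n.+1 a :: X n (flip c) :: r).
Proof. exact (ref_app r (cup_slide_rev Y n c a)). Qed.
Lemma cap_slide_c n c r :
  ref (X n c :: A n.+1 :: r) (X n.+1 (flip c) :: A n :: r).
Proof. exact (ref_app r (cap_slide Y n c)). Qed.
Lemma cap_slide_rev_c n c r :
  ref (X n.+1 c :: A n :: r) (X n (flip c) :: A n.+1 :: r).
Proof. exact (ref_app r (cap_slide_rev Y n c)). Qed.

(** One of the two virtual crossings with the legs of the minimum slides through it and cancels the
    other. *)
Lemma mvr_cup n a i k r : i <= n -> n <= i + k ->
  ref (U n.+1 a :: mvr i k.+2 ++ r) (mvr i k ++ U n a :: r).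
Proof.
move=> h1 h2; rewrite (mvr_split h1 h2) (mvr_join h1 h2) -!catA /=.
have hw : inX i n.+1 (mvr i (n - i)) by apply: inX_mvr; lia.
have hw' : inX n (i + k).+1 (mvr n (i + k - n)) by apply: inX_mvr; lia.
rewrite -> (pass_left_rev_c Y _ _ hw) => //; rewrite -> cup_slide_c, (cancelV Y).
by rewrite -[n.+2]/(2 + n) -shift_mvr; rewrite -> (proj1 (pass_cup _ _ hw' (leqnn _))); reflexivity.
Qed.

Lemma mvr_cap n i k r : i <= n -> n <= i + k ->
  ref (mvr i k.+2 ++ A n :: r) (A n.+1 :: mvr i k ++ r).
Proof.
move=> h1 h2; rewrite (mvr_split h1 h2) (mvr_join h1 h2) -!catA /=.
have hw : inX i n.+1 (mvr i (n - i)) by apply: inX_mvr; lia.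
have hw' : inX n (i + k).+1 (mvr n (i + k - n)) by apply: inX_mvr; lia.
rewrite -[n.+2]/(2 + n) -shift_mvr; rewrite -> (pass_cap _ hw' (leqnn _)).
by rewrite -> cap_slide_rev_c, (cancelV Y), (pass_left_c Y _ _ hw); [reflexivity|].
Qed.

Lemma mvl_cross n c i k r : i <= n -> n.+2 <= i + k ->
  ref (X n c :: mvl i k ++ r) (mvl i k ++ X n.+1 c :: r) /\
  ref (mvl i k ++ X n.+1 c :: r) (X n c :: mvl i k ++ r).
Proof.
move=> h1; case: k => [|[|k]] h2; [lia|lia|]; rewrite (@mvl_split i n) //; last lia.
have hw : inX i n.+1 (mvl i (n - i)) by apply: inX_mvl; lia.
have hw' : inX n.+2 (i + k).+4 (mvl n.+2 (i + k - n)) by apply: inX_mvl; lia.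
rewrite -!catA /=; split.
  rewrite -> (proj1 (pass_cross_c _ _ hw' (leqnn _))), (detourl Y).
  by rewrite -> (pass_left_rev_c Y _ _ hw); [reflexivity|].
rewrite -> (pass_left_c Y _ _ hw), (detourl_rev Y) => //.
by rewrite -> (proj2 (pass_cross_c _ _ hw' (leqnn _))); reflexivity.
Qed.

Lemma mvl_cup n a i k r : i <= n -> n <= i + k ->
  ref (U n a :: mvl i k.+2 ++ r) (mvl i k ++ U n.+1 a :: r).
Proof.
move=> h1 h2; rewrite (mvl_split h1 h2) (mvl_join h1 h2) -!catA /=.
have hw : inX i n.+1 (mvl i (n - i)) by apply: inX_mvl; lia.
have hw' : inX n (i + k).+1 (mvl n (i + k - n)) by apply: inX_mvl; lia.
rewrite -[n.+2]/(2 + n) -shift_mvl; rewrite -> (proj1 (pass_cup _ _ hw' (leqnn _))).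
by rewrite -> cup_slide_rev_c, (cancelV Y), (pass_left_rev_c Y _ _ hw); [reflexivity|].
Qed.

Lemma mvl_cap n i k r : i <= n -> n <= i + k ->
  ref (mvl i k.+2 ++ A n.+1 :: r) (A n :: mvl i k ++ r).
Proof.
move=> h1 h2; rewrite (mvl_split h1 h2) (mvl_join h1 h2) -!catA /=.
have hw : inX i n.+1 (mvl i (n - i)) by apply: inX_mvl; lia.
have hw' : inX n (i + k).+1 (mvl n (i + k - n)) by apply: inX_mvl; lia.
rewrite -> (pass_left_c Y _ _ hw), cap_slide_c, (cancelV Y) => //.
by rewrite -[n.+2]/(2 + n) -shift_mvl; rewrite -> (pass_cap _ hw' (leqnn _)); reflexivity.
Qed.

End Beads.

(** The travelling strand goes across by one crossing and returns by the other. A flat crossing has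
    two senses, so it matters which of the two is real. *)
Definition hook (t : bool) k : word := if t then [:: V k; F k] else [:: F k; V k].

(* [bead t k]: the leftmost strand meets the strand [k.+1] in one real crossing,
   reached and left through virtual crossings only. *)
Fact bead_key : unit. Proof. exact: tt. Qed.
Definition bead (t : bool) k : word :=
  locked_with bead_key (mvr 0 k ++ hook t k ++ mvl 0 k).

Lemma beadE t k : bead t k = mvr 0 k ++ hook t k ++ mvl 0 k.
Proof. exact: unlock. Qed.



Section Beads.
Context (Y : xmove).
Notation ref := (ref Y).
Notation refs := (refs Y).

Lemma inX_hook t k : inX k k.+2 (hook t k).
Proof. by case: t; rewrite /= !leqnn. Qed.

Lemma inX_bead t k : inX 0 k.+2 (bead t k).
Proof. by rewrite !beadE !inX_cat inX_mvr ?inX_mvl //; case: t => /=; rewrite leqnn. Qed.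

Lemma inX_capless lo hi w : inX lo hi w -> capless w.
Proof. by apply: sub_all => -[n []]. Qed.

Lemma capless_bead t k : capless (bead t k).
Proof. exact: inX_capless (inX_bead t k). Qed.

Ltac caplessness := by rewrite ?(capless_bead, capless_nil, capless_cons, capless_cat).

Lemma wsize_allX lo hi w j : inX lo hi w ->
  wsize j w = if all (fun g : gen => g.1.+2 <= j) w then Some j else None.
Proof.
elim: w => [|[n [b||c]] w IH] //= /andP[_ /IH h].
by rewrite addn2; case: leqP => //= hj; rewrite subnK ?h //; lia.
Qed.

Lemma wsize_bead t k j : wsize j (bead t k) = if k.+2 <= j then Some j else None.
Proof.
rewrite (wsize_allX _ (inX_bead t k)); congr (if _ then _ else _).
apply/idP/idP; first by rewrite !beadE !all_cat; case: t => /=; case/and3P=> _ /andP[].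
move=> hj; have := inX_bead t k; apply: sub_all => -[n [b||c]] //= h; lia.
Qed.

Lemma wsize_mvr i k j : 0 < k -> wsize j (mvr i k) = if i + k < j then Some j else None.
Proof.
case: k => // k _; have h : inX i (i + k).+2 (mvr i k.+1) by apply: inX_mvr; lia.
rewrite (wsize_allX _ h); congr (if _ then _ else _); apply/idP/idP.
  by rewrite mvrS all_cat => /andP[_ /=]; lia.
by move=> hj; move: h; apply: sub_all => -[n [b||c]] //= hn; lia.
Qed.

(** The way back of the first bead cancels the way out of the second; the two hooks are then inverse
    to each other. *)
Lemma bead_cancel t k r : ref (bead t k ++ bead (~~ t) k ++ r) r.
Proof.
rewrite !beadE -!catA; rewrite -> (catA (mvl 0 k)), (mvl_mvr Y).
rewrite (_ : hook t k ++ [::] ++ _ = (hook t k ++ hook (~~ t) k) ++ mvl 0 k ++ r); last first.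
  by rewrite -!catA.
have e : ref (hook t k ++ hook (~~ t) k) [::].
  by case: t => /=; [rewrite -> (cancelF Y), (cancelV Y) | rewrite -> (cancelV Y), (cancelF Y)]; reflexivity.
by rewrite -> e; rewrite /= catA; rewrite -> (mvr_mvl Y); reflexivity.
Qed.

Lemma bead_right t k n K r : k.+2 <= n ->
  ref (bead t k ++ (n, K) :: r) ((n, K) :: bead t k ++ r).
Proof. by move=> h; apply: pass_left_c (inX_bead t k) h. Qed.
Lemma bead_right_rev t k n K r : k.+2 <= n ->
  ref ((n, K) :: bead t k ++ r) (bead t k ++ (n, K) :: r).
Proof. by move=> h; apply: pass_left_rev_c (inX_bead t k) h. Qed.

(** Mixed moves carry the crossing through the way out of x, which shifts it to [n.-1], and through
    the way back, which restores its position. *)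
Lemma bead_left_cross t k n c r : 0 < n -> n < k ->
  ref (X n c :: bead t k ++ r) (bead t k ++ X n c :: r) /\
  ref (bead t k ++ X n c :: r) (X n c :: bead t k ++ r).
Proof.
case: n => // n _ hn; rewrite !beadE -!catA.
have [h1 h2] := @mvr_cross Y n.+1 c 0 k isT hn.
have [h3 h4] := @mvl_cross Y n c 0 k r isT hn.
have k1 : n.+2 <= k by [].
split.
- have := ref_app (hook t k ++ mvl 0 k ++ r) h1; rewrite /= -catA /= => e; rewrite -> e.
  rewrite -> (pass_cross_c Y c (mvl 0 k ++ r) (inX_hook t k) k1).1.
  by rewrite -> h3; reflexivity.
- rewrite -> h4; rewrite -> (pass_cross_c Y c (mvl 0 k ++ r) (inX_hook t k) k1).2.
  by have := ref_app (hook t k ++ mvl 0 k ++ r) h2; rewrite /= -catA /= => e; rewrite -> e; reflexivity.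
Qed.

Lemma bead_left_cup t k n a r : n <= k ->
  ref (U n.+1 a :: bead t k.+2 ++ r) (bead t k ++ U n.+1 a :: r) /\
  ref (bead t k ++ U n.+1 a :: r) (U n.+1 a :: bead t k.+2 ++ r).
Proof.
move=> hn.
have h s : ref (U n.+1 a :: bead t k.+2 ++ s) (bead t k ++ U n.+1 a :: s).
  have hk : n <= 0 + k by [].
  rewrite !beadE -!catA; rewrite -> (mvr_cup Y a _ (leq0n n) hk).
  have -> : hook t k.+2 = shift 2 (hook t k) by case: (t).
  rewrite -> (pass_cup Y a _ (inX_hook t k) hn).1.
  by rewrite -> (mvl_cup Y a _ (leq0n n) hk); reflexivity.
split; first exact: h.
have e : ref (bead t k ++ [:: U n.+1 a]) (U n.+1 a :: bead t k.+2).
  apply: ref_rev_capless; first by have := h [::]; rewrite cats0.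
    caplessness.
  by move=> j; rewrite wsize_cat /= !wsize_bead; repeat (case: ifP => //= ?); lia.
by have := ref_app r e; rewrite -catA.
Qed.

Lemma bead_left_cap t k n r : n <= k ->
  ref (bead t k.+2 ++ A n.+1 :: r) (A n.+1 :: bead t k ++ r).
Proof.
move=> hn; have hk : n <= 0 + k by [].
rewrite !beadE -!catA; rewrite -> (mvl_cap Y _ (leq0n n) hk).
have -> : hook t k.+2 = shift 2 (hook t k) by case: (t).
rewrite -> (pass_cap Y _ (inX_hook t k) hn).
by rewrite -> (mvr_cap Y _ (leq0n n) hk); reflexivity.
Qed.

(** The crossing [V k.+1] takes the strand of the bead one place to the left, and mixed moves let
    the bead follow it. *)
Lemma bead_slide t k r :
  ref (bead t k.+1 ++ V k.+1 :: r) (V k.+1 :: bead t k ++ r).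
Proof.
rewrite !beadE mvrS mvlS -!catA /= add0n.
have hr : inX 0 k.+1 (mvr 0 k) by apply: inX_mvr.
have hl : inX 0 k.+1 (mvl 0 k) by apply: inX_mvl.
rewrite -> (pass_left_c Y _ _ hl) => //; rewrite <- (pass_left_c Y _ _ hr) => //.
set w := mvl 0 k ++ r; case: t => /=.
- rewrite -> (detour Y k (Real true)), (detour_rev Y k Virtual), (cancelV Y k.+1).
  reflexivity.
- rewrite -> (detour Y k Virtual), (detour Y k (Real true)), (cancelV Y k); reflexivity.
Qed.

Lemma bead_slide_rev t k r :
  ref (V k.+1 :: bead t k ++ r) (bead t k.+1 ++ V k.+1 :: r).
Proof.
have e : ref (V k.+1 :: bead t k) (bead t k.+1 ++ [:: V k.+1]).
  apply: ref_rev_capless; first by have := bead_slide t k [::]; rewrite cats0.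
    caplessness.
  by move=> j; rewrite wsize_cat /= !wsize_bead; repeat (case: ifP => //= ?); lia.
by have := ref_app r e; rewrite /= -catA.
Qed.

(** Here the strand of the bead goes to the right. A cancelling pair of virtual crossings, inserted
    above, reduces this to [bead_slide]. *)
Lemma bead_unslide t k r :
  ref (bead t k ++ V k.+1 :: r) (V k.+1 :: bead t k.+1 ++ r) /\
  ref (V k.+1 :: bead t k.+1 ++ r) (bead t k ++ V k.+1 :: r).
Proof.
have h : ref (V k.+1 :: bead t k.+1) (bead t k ++ [:: V k.+1]).
  transitivity (V k.+1 :: bead t k.+1 ++ [:: V k.+1; V k.+1]).
    apply: ref_rev_capless; first by rewrite -> (cancelV Y); rewrite cats0; reflexivity.
      caplessness.
    by move=> j; rewrite /= !wsize_cat !wsize_bead; repeat (case: ifP => //= ?); lia.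
  by rewrite -> bead_slide, (cancelV Y); reflexivity.
split; last by have := ref_app r h; rewrite /= -catA.
have e : ref (bead t k ++ [:: V k.+1]) (V k.+1 :: bead t k.+1).
  apply: ref_rev_capless h _ _.
    caplessness.
  by move=> j; rewrite wsize_cat /= !wsize_bead; repeat (case: ifP => //= ?); lia.
by have := ref_app r e; rewrite /= -catA.
Qed.

(** The first virtual crossing at the minimum slides through it and cancels the next one. The flat
    crossing then slides to the left leg, where it precedes the remaining virtual crossing: the type
    has changed. *)
Lemma bead_turn_true k a r :
  ref (U k.+1 a :: bead true k.+1 ++ r) (U k.+1 a :: bead false k ++ r).
Proof.
rewrite !beadE mvrS mvlS -!catA /= add0n.
have hr : inX 0 k.+1 (mvr 0 k) by apply: inX_mvr.
rewrite -> (pass_left_rev_c Y (Kcup a) _ hr) => //; rewrite <- (pass_left_c Y (Kcup a) _ hr) => //.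
rewrite -> (cup_slide_c Y k Virtual), (cancelV Y k.+1), (flat_cup_slide_rev Y k); reflexivity.
Qed.

Lemma bead_turn_rev t k a : 
  ref (U k.+1 a :: bead (~~ t) k.+1) (U k.+1 a :: bead t k) ->
  ref (U k.+1 a :: bead t k) (U k.+1 a :: bead (~~ t) k.+1).
Proof.
move=> h; apply: ref_rev_capless h _ _.
  caplessness.
by move=> j; rewrite /= !wsize_bead; repeat (case: ifP => //= ?); lia.
Qed.

(* A virtual kink exchanges the legs of the minimum, which deduces one type of
   bead from the other. *)
Lemma bead_turn t k a r :
  ref (U k.+1 a :: bead t k.+1 ++ r) (U k.+1 a :: bead (~~ t) k ++ r) /\
  ref (U k.+1 a :: bead t k ++ r) (U k.+1 a :: bead (~~ t) k.+1 ++ r).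
Proof.
have kink : ref [:: U k.+1 a] [:: U k.+1 (~~ a); V k.+1].
  apply: ref_rev_capless; [|by []|]; first by have := kink_cup Y k.+1 (~~ a) Virtual; rewrite negbK.
  by move=> j /=; repeat (case: ifP => //= ?); lia.
have h1 b s : ref (U k.+1 b :: bead false k ++ s) (U k.+1 b :: bead true k.+1 ++ s).
  have e := @bead_turn_rev false k b.
  have := bead_turn_true k b [::]; rewrite !cats0 => /e{}e.
  exact (ref_app s e).
have h2 : ref (U k.+1 a :: bead false k.+1) (U k.+1 a :: bead true k).
  rewrite -[_ :: bead false _]cat1s; rewrite -> kink => /=; rewrite -[bead false _]cats0.
  rewrite -> (bead_unslide false k [::]).2, h1, (bead_slide true k).
  rewrite cats0; have := ref_app (bead true k) (kink_cup Y k.+1 (~~ a) Virtual).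
  by rewrite negbK.
have h3 := @bead_turn_rev true k a h2.
case: t; split; [exact: bead_turn_true | exact (ref_app r h3) | exact (ref_app r h2) | exact: h1].
Qed.

(** Only the two legs of the first minimum take part, so both crossings of the bead are kinks at
    this minimum. *)
Lemma bead_absorb t b r : ref (U 0 b :: bead t 0 ++ r) (U 0 b :: r).
Proof.
have h c c' : ref [:: U 0 b; X 0 c; X 0 c'] [:: U 0 b].
  transitivity [:: U 0 (~~ b); X 0 c']; first exact (ref_app [:: X 0 c'] (kink_cup Y 0 b c)).
  by have := kink_cup Y 0 (~~ b) c'; rewrite negbK.
by rewrite beadE; case: t; [have := ref_app r (h Virtual (Real true)) | have := ref_app r (h (Real true) Virtual)].
Qed.
End Beads.

Lemma gX_cat c p x y w : let s := p ++ x :: y :: w in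
  gok s (X (size p) c) /\ gtgt s (X (size p) c) = p ++ y :: x :: w.
Proof. by have [h1 _ h2] := glayer_cat p (Cross c x y) w. Qed.

Lemma tgt_cons s g w : tgt s (g :: w) = tgt (gtgt s g) w.
Proof. by []. Qed.

Lemma tgt_mvr p x u w :
  tgt (p ++ x :: u ++ w) (mvr (size p) (size u)) = p ++ u ++ x :: w.
Proof.
elim: u p => [|y u IH] p; first by [].
rewrite mvrS' tgt_cons (gX_cat _ _ _ _ _).2.
by have := IH (rcons p y); rewrite size_rcons -!cats1 -!catA.
Qed.

Lemma tgt_mvl p x u w :
  tgt (p ++ u ++ x :: w) (mvl (size p) (size u)) = p ++ x :: u ++ w.
Proof.
elim/last_ind: u w => [|u y IH] w; first by [].
rewrite size_rcons mvlS tgt_cons -cats1 -catA /= catA -size_cat.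
by rewrite (gX_cat _ _ _ _ _).2 -catA IH -catA.
Qed.

Lemma tgt_bead t k s : k.+2 <= size s -> tgt s (bead t k) = s.
Proof.
case: s => // x s hk; have : k + 1 <= size s by rewrite addn1.
move=> /window[u [s0 [v [-> <-]]]]; case: s0 => [|y []] // _; rewrite beadE !tgt_cat.
rewrite -[x :: _]/([::] ++ x :: u ++ y :: v) (tgt_mvr [::]) /=.
have -> : tgt (u ++ [:: x, y & v]) (hook t (size u)) = u ++ [:: x, y & v].
  by case: t; rewrite /= !(gX_cat _ _ _ _ _).2.
exact: (tgt_mvl [::]).
Qed.

(** * A flat crossing as a virtual crossing with two beads; commutation of beads *)

Section CrossBeads.
Context (Y : xmove).
Notation ref := (ref Y).
Notation refs := (refs Y).

Lemma ref_rev_X hi w w' : ref w' w -> inX 0 hi w -> inX 0 hi w' ->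
  (forall j, all (fun g : gen => g.1.+2 <= j) w -> hi <= j) -> ref w w'.
Proof.
move=> h hw hw' hj; apply: ref_rev_capless h _ _.
  by rewrite capless_cat !(inX_capless (lo := 0) (hi := hi)).
move=> j; rewrite (wsize_allX _ hw); case: ifP => // /hj h _.
by rewrite (wsize_inX hw').
Qed.

(** The trips of x between the two beads cancel: x goes out past both strands virtually and comes
    back through the two flat crossings. *)
Lemma two_beads k r : ref (bead true k.+1 ++ bead true k ++ r)
  (mvr 0 k ++ V k :: V k.+1 :: F k.+1 :: F k :: mvl 0 k ++ r).
Proof.
rewrite !beadE mvrS mvlS -!catA /= add0n.
rewrite -> (catA (mvl 0 k)), (mvl_mvr Y) => /=.
rewrite -> (cancelV Y k); reflexivity.
Qed.

(** Inserted cancelling crossings complete [F 1] to a flat triangle. The virtual crossing comes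
    first, and the bead met first above it is on the right strand. *)
Lemma flat_crossing_21 b :
  refs [:: b; midstrand Y b; b] [:: F 1] [:: V 1; V 0; V 1; F 1; F 0].
Proof.
transitivity [:: F 1; F 0; F 1; F 1; F 0].
  by apply: refs_rev => //; rewrite -> (cancelF Y 1), (cancelF Y 0); reflexivity.
rewrite -> (flat_R3_rev Y 0).
transitivity [:: V 0; V 1; V 0; F 1; F 0].
  exact (refs_app [:: F 1; F 0] (flat_triangle Y b)).
rewrite -> (detour_rev Y 0 Virtual); reflexivity.
Qed.

(** Here the triangle is completed above a virtual detour of x, which leaves the beads below the
    virtual crossing. Lifted above it they exchange strands, and so appear in the order opposite to
    that of [flat_crossing_21]. *)
Lemma flat_crossing_12 b :
  refs [:: b; midstrand Y b; b] [:: F 1] [:: V 0; V 1; F 1; F 0; V 1].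
Proof.
transitivity [:: F 1; V 0; V 1; V 1; V 0].
  by apply: refs_rev => //; rewrite -> (cancelV Y 1), (cancelV Y 0); reflexivity.
rewrite -> (detour Y 0 (Real true)).
transitivity [:: V 0; V 1; F 1; F 0; F 0; F 1; F 0; V 1; V 0].
  by apply: refs_rev => //; rewrite -> (cancelF Y 0 (F 1 :: _)), (cancelF Y 1); reflexivity.
transitivity [:: V 0; V 1; F 1; F 0; V 0; V 1; V 0; V 1; V 0].
  apply: (@refs_pre Y _ [:: V 0; V 1; F 1; F 0]).
  exact (refs_app [:: V 1; V 0] (flat_triangle Y b)).
rewrite -> (detour_rev Y 0 Virtual [:: V 1; V 0]), (cancelV Y 1), (cancelV Y 0); reflexivity.
Qed.

(** Above the virtual crossing [z] is on the left, so [t] is the type of the bead on [z] and [t']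
    that of the bead on [y]. Both orders are demanded, since their equality is the source of
    commutation. *)
Definition cross_beads x y z t t' := forall u v, let s := x :: u ++ [:: y, z & v] in
  let k := size u in
  refs s [:: F k.+1] (V k.+1 :: bead t k ++ bead t' k.+1) /\
  refs s [:: F k.+1] (V k.+1 :: bead t' k.+1 ++ bead t k).

Lemma cross_beads_mid b : cross_beads b (midstrand Y b) b true true.
Proof.
move=> u v s k; set c := midstrand Y b.
have h0 : inX 0 k.+3 (mvr 0 k) by apply: inX_mvr; lia.
have h1 : inX 0 k.+3 (mvl 0 k) by apply: inX_mvl; lia.
have hl : inX 0 k.+1 (mvl 0 k) by apply: inX_mvl; lia.
have hr : inX 0 k.+1 (mvr 0 k) by apply: inX_mvr; lia.
have hb t i : i <= k.+1 -> inX 0 k.+3 (bead t i).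
  by move=> hi; move: (inX_bead t i); apply: sub_all => -[n [b'||c']] //=; lia.
(* A detour of x across [u] and back, around the crossing, makes the strands x, [y], [z]
   consecutive. *)
have start : ref [:: F k.+1] (mvr 0 k ++ F k.+1 :: mvl 0 k).
  have e : ref (mvr 0 k ++ F k.+1 :: mvl 0 k) [:: F k.+1].
    rewrite -[mvl 0 k]cats0; rewrite -> (pass_left_rev_c Y _ _ hl) => //.
    by rewrite catA; rewrite -> (mvr_mvl Y); reflexivity.
  apply: (ref_rev_X (hi := k.+3) e); rewrite ?inX_cat ?h0 /= ?h1 ?leqnn //.
  by move=> j; rewrite andbT.
have local w : refs [:: b; c; b] [:: F 1] w -> wsize 3 w ->
    refs s [:: F k.+1] (mvr 0 k ++ shift k w ++ mvl 0 k).
  move=> hw sw; rewrite -> start; apply: refs_pre.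
  rewrite /s (tgt_mvr [::] b u [:: c, b & v]).
  have := refs_app (mvl 0 k) (refs_window u v hw isT sw).
  by rewrite /= addn1.
split.
- have := local _ (flat_crossing_12 b) isT; rewrite /= addn0 addn1 => e; rewrite -> e.
  apply: ref_refs; apply: (@ref_rev_X k.+3).
  + have e' := (bead_unslide Y true k [::]).2; rewrite !cats0 in e'.
    rewrite -> (bead_slide_rev Y true k), e', two_beads, (pass_left_c Y _ [::] hl) => //.
    by rewrite cats0; reflexivity.
  + by rewrite inX_cat h0 /= h1 !leqnn /= !andbT; lia.
  + by rewrite /= inX_cat !hb // !leqnn.
  + by move=> j; rewrite all_cat /=; lia.
- have := local _ (flat_crossing_21 b) isT; rewrite /= addn0 addn1 => e; rewrite -> e.
  apply: ref_refs; apply: (@ref_rev_X k.+3).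
  + rewrite -[bead true k]cats0; rewrite -> two_beads, cats0.
    by rewrite -> (pass_left_rev_c Y _ _ hr); [reflexivity|].
  + by rewrite inX_cat h0 /= h1 !leqnn /= !andbT; lia.
  + by rewrite /= inX_cat !hb // !leqnn.
  + by move=> j; rewrite all_cat /=; lia.
Qed.


Lemma refs_window_at u s0 v w w' n : refs s0 w w' -> wsize (size s0) w ->
  wsize (size s0) w' -> n = size u -> refs (u ++ s0 ++ v) (shift n w) (shift n w').
Proof. by move=> h h1 h2 ->; apply: refs_window. Qed.

(* A quarter turn of the crossing; three of them reach all orientations. *)
Lemma cross_beads_turn x y z t t' : cross_beads x (~~ z) y t t' -> cross_beads x y z (~~ t') t.
Proof.
move=> h u v s k.
have sE : s = (x :: u) ++ [:: y; z] ++ v by [].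
have hs : k.+2 <= size s by rewrite /s /= size_cat /=; lia.
have turn : refs s [:: F k.+1] [:: U k.+1 z; F k.+2; A k.+3].
  have := refs_window_at (u := x :: u) v (quarter_turn Y y z (Real true)) isT isT (erefl k.+1).
  rewrite -sE /= !(addn0, addn1, addn2) => e; rewrite -> e.
  rewrite -> (ref_app [:: A k.+3] (crossing_change Y k.+2 false true)); reflexivity.
have unturn : refs s [:: U k.+1 z; V k.+2; A k.+3] [:: V k.+1].
  have e : refs [:: y; z] [:: U 0 z; V 1; A 2] [:: V 0].
    by apply: refs_rev (quarter_turn Y y z Virtual) _; case: (y) (z) => [] [].
  have := refs_window_at (u := x :: u) v e isT isT (erefl k.+1).
  by rewrite -sE /= !(addn0, addn1, addn2).
have mid w : refs (x :: rcons u z ++ [:: ~~ z, y & z :: v]) [:: F k.+2] w ->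
    refs s [:: F k.+1] (U k.+1 z :: w ++ [:: A k.+3]).
  move=> e; rewrite -> turn; apply: (@refs_pre Y s [:: U k.+1 z]).
  apply: (@refs_app Y _ [:: F k.+2]); move: e; rewrite tgt_cons /=.
  have [_ _] := glayer_cat (x :: u) (Cup z) [:: y, z & v].
  by rewrite [gtgt _ _]/= => ->; rewrite -cats1 /= -catA.
have [h1 h2] := h (rcons u z) (z :: v).
move: h1 h2; rewrite size_rcons -/k => /mid h1 /mid h2.
split.
- transitivity ([:: U k.+1 z; V k.+2; A k.+3] ++ bead (~~ t') k ++ bead t k.+1).
    (* The bead of type [t'] lies on the bent strand. It goes back through the virtual crossing,
       then around the minimum, where its type changes, and ends on the strand [z]. *)
    rewrite -> h2; apply: ref_refs; rewrite /= -!catA.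
    rewrite -> (bead_unslide Y t' k.+1 _).2, (bead_turn Y t' k z _).1.
    rewrite -> (bead_right Y (~~ t') _ _ (leqnn k.+2)), (bead_right Y t _ _ (leqnn k.+3)).
    by rewrite -> (@bead_right Y (~~ t') k k.+3 Kcap); [rewrite cats0; reflexivity|].
  exact (refs_app _ unturn).
- transitivity (bead t k ++ [:: U k.+1 z; V k.+2; A k.+3] ++ bead (~~ t') k).
    rewrite -> h1; apply: ref_refs; rewrite /= -!catA.
    rewrite -> (bead_slide_rev Y t k.+1 _), (bead_left_cup Y t z _ (leqnn k)).1.
    rewrite -> (bead_unslide Y t' k.+1 _).2, (bead_turn Y t' k z _).1.
    rewrite -> (bead_right Y (~~ t') _ _ (leqnn k.+2)).
    by rewrite -> (@bead_right Y (~~ t') k k.+3 Kcap); [rewrite cats0; reflexivity|].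
  transitivity (bead t k ++ V k.+1 :: bead (~~ t') k).
    by apply: refs_pre; rewrite tgt_bead //; exact (refs_app _ unturn).
  by rewrite -> (bead_unslide Y t k _).1; reflexivity.
Qed.

Lemma cross_beads_any x y z : exists t t', cross_beads x y z t t'.
Proof.
have h0 := cross_beads_mid x.
have turn y' z' : (exists t t', cross_beads x (~~ z') y' t t') -> exists t t', cross_beads x y' z' t t'.
  by case=> t [t' /cross_beads_turn h]; exists (~~ t'), t.
have {}h0 : exists t t', cross_beads x (midstrand Y x) x t t' by exists true, true.
have h1 := turn x (~~ midstrand Y x); rewrite negbK in h1; have {}h1 := h1 h0.
have h2 := turn (~~ midstrand Y x) (~~ x); rewrite negbK in h2; have {}h2 := h2 h1.
have h3 := turn (~~ x) (midstrand Y x) h2.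
move: h0 h1 h2 h3; case: (midstrand Y x); case: x {turn}; case: y; case: z.
all: done.
Qed.

(** Above a virtual crossing, both orders of the beads give the same flat crossing, hence agree. The
    types obtained depend on the orientations in the source; the other types follow by conjugation,
    because beads of opposite types are inverse to each other. *)
Lemma bead_comm_next t t' k : ref (bead t k ++ bead t' k.+1) (bead t' k.+1 ++ bead t k) /\
  ref (bead t' k.+1 ++ bead t k) (bead t k ++ bead t' k.+1).
Proof.
have hb t0 i : i <= k.+1 -> inX 0 k.+3 (bead t0 i).
  by move=> hi; move: (inX_bead t0 i); apply: sub_all => -[n [b'||c']] //=; lia.
have hj j : all (fun g : gen => g.1.+2 <= j) (bead t' k.+1 ++ bead t k) -> k.+3 <= j.
  by rewrite all_cat => /andP[+ _]; rewrite beadE !all_cat; case: (t') => /=; case/and3P=> _ /andP[].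
have okb s t0 i : i <= k.+1 -> k.+3 <= size s -> ok s (bead t0 i).
  move=> hi hs; rewrite ok_capless ?capless_bead // wsize_bead ifT //; lia.
suff h : ref (bead t k ++ bead t' k.+1) (bead t' k.+1 ++ bead t k).
  split=> //; apply: (@ref_rev_X k.+3) => //; rewrite inX_cat !hb //; lia.
split=> s; case hs : (k.+3 <= size s); last first.
  split; rewrite ok_capless ?capless_cat ?capless_bead // wsize_cat wsize_bead.
  by case: ifP => //= _; rewrite wsize_bead hs.
pose C t1 t2 := refs s (bead t1 k ++ bead t2 k.+1) (bead t2 k.+1 ++ bead t1 k).
have tb t0 i : i <= k.+1 -> tgt s (bead t0 i) = s by move=> hi; apply: tgt_bead; lia.
have okb2 t1 t2 i j : i <= k.+1 -> j <= k.+1 -> ok s (bead t1 i ++ bead t2 j).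
  by move=> hi hj'; rewrite ok_cat tb ?okb.
have C_rev t1 t2 : C t1 t2 -> refs s (bead t2 k.+1 ++ bead t1 k) (bead t1 k ++ bead t2 k.+1).
  by move=> h; apply: refs_rev h _ => _; apply: okb2.
have insert t0 i : i <= k.+1 -> refs s [::] (bead t0 i ++ bead (~~ t0) i).
  move=> hi; apply: refs_rev => [|_]; last exact: okb2.
  by have e := bead_cancel Y t0 i [::]; rewrite cats0 in e; rewrite -> e; reflexivity.
have C_l t1 t2 : C t1 t2 -> C (~~ t1) t2.
  move=> h; rewrite /C.
  transitivity (bead (~~ t1) k ++ bead t2 k.+1 ++ bead t1 k ++ bead (~~ t1) k).
    apply: refs_pre; rewrite tb //; rewrite -{1}[bead t2 _]cats0.
    by apply: refs_pre; rewrite tb //; apply: insert.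
  transitivity (bead (~~ t1) k ++ (bead t1 k ++ bead t2 k.+1) ++ bead (~~ t1) k).
    apply: refs_pre; rewrite tb // catA; apply: refs_app; exact: C_rev.
  have e := bead_cancel Y (~~ t1) k; rewrite negbK in e.
  by rewrite -catA; rewrite -> e; reflexivity.
have C_r t1 t2 : C t1 t2 -> C t1 (~~ t2).
  move=> h; rewrite /C.
  transitivity ((bead (~~ t2) k.+1 ++ bead t2 k.+1) ++ bead t1 k ++ bead (~~ t2) k.+1).
    by apply: (@refs_app Y s [::]); have := insert (~~ t2) k.+1 (leqnn _); rewrite negbK.
  transitivity (bead (~~ t2) k.+1 ++ (bead t1 k ++ bead t2 k.+1) ++ bead (~~ t2) k.+1).
    rewrite -catA; apply: refs_pre; rewrite tb // catA; apply: refs_app; exact: C_rev.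
  by have e := bead_cancel Y t2 k.+1 [::]; rewrite cats0 in e; rewrite -catA; rewrite -> e; rewrite cats0; reflexivity.
suff [t1 [t2 h]] : exists t1 t2, C t1 t2.
  rewrite -/(C t t'); have [->|/negbTE e] := eqVneq t t1; have [->|/negbTE e'] := eqVneq t' t2 => //.
  - have -> : t' = ~~ t2 by move: e'; case: (t') (t2) => [] [].
    exact: C_r.
  - have -> : t = ~~ t1 by move: e; case: (t) (t1) => [] [].
    exact: C_l.
  - have -> : t' = ~~ t2 by move: e'; case: (t') (t2) => [] [].
    have -> : t = ~~ t1 by move: e; case: (t) (t1) => [] [].
    exact/C_l/C_r.
case: s hs @C {tb okb2 C_rev insert C_l C_r} => // x s hs C.
have /window[u [s0 [v [sE hu]]]] : k + 2 <= size s by rewrite addn2.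
case: s0 sE => [|y [|z []]] // sE _.
(* The order is [z], [y]: the flat crossing is placed above an inserted virtual crossing which has
   exchanged these strands. *)
have [t1 [t2 h]] := cross_beads_any x z y; exists t1, t2.
have [h1 h2] := h u v; rewrite hu in h1 h2; rewrite /C.
set s1 := x :: s; set s2 := x :: u ++ [:: z, y & v] in h1 h2.
have hv w : refs s1 w (V k.+1 :: V k.+1 :: w).
  apply: (@refs_app Y s1 [::] w [:: V k.+1; V k.+1]); apply: refs_rev => [|_].
    exact (refP (cancelV Y k.+1 [::]) _).
  by rewrite ok_capless // (wsize_inX (lo := 0) (hi := k.+3)) //= leqnn.
have tv : tgt s1 [:: V k.+1] = s2.
  have := (gX_cat Virtual (x :: u) y z v).2; rewrite /s1 sE /= hu; exact.
transitivity (V k.+1 :: V k.+1 :: bead t1 k ++ bead t2 k.+1); first exact: hv.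
transitivity (V k.+1 :: V k.+1 :: bead t2 k.+1 ++ bead t1 k).
  apply: (@refs_pre Y s1 [:: V k.+1]); rewrite tv.
  transitivity [:: F k.+1]; last exact: h2.
  apply: refs_rev h1 _ => _; rewrite ok_capless // (wsize_inX (lo := 0) (hi := k.+3)) //= ?leqnn //.
  by rewrite size_cat /= hu; lia.
by rewrite -> (cancelV Y k.+1); reflexivity.
Qed.

(** Induction on the distance of the strands: conjugation by a virtual crossing moves the farther
    bead one strand closer, and this crossing lies to the right of the other bead. *)
Lemma bead_comm t t' k l r : k != l -> ref (bead t k ++ bead t' l ++ r) (bead t' l ++ bead t k ++ r).
Proof.
suff h d i j a b : j = i + d.+1 ->
    ref (bead a i ++ bead b j) (bead b j ++ bead a i) /\
    ref (bead b j ++ bead a i) (bead a i ++ bead b j).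
  rewrite neq_ltn !catA => /orP[] hkl.
    have [h1 _] := h (l - k.+1) k l t t' ltac:(lia); exact (ref_app r h1).
  have [_ h1] := h (k - l.+1) l k t' t ltac:(lia); exact (ref_app r h1).
elim: d i j a b => [|d IH] i j a b ->; first by rewrite addn1; exact: bead_comm_next.
rewrite addnS; set m := i + d.+1; have [h1 h2] := IH i m a b erefl.
have ins : ref (bead b m.+1) (V m.+1 :: bead b m ++ [:: V m.+1]).
  transitivity (bead b m.+1 ++ [:: V m.+1; V m.+1]).
    apply: (@ref_rev_X m.+3).
    - by rewrite -> (cancelV Y); rewrite cats0; reflexivity.
    - exact: inX_bead.
    - by rewrite inX_cat inX_bead /= ltnSn.
    - by move=> q hq; have := wsize_allX q (inX_bead b m.+1); rewrite hq wsize_bead; case: ifP.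
  by rewrite -> (bead_slide Y b m [:: V m.+1]); reflexivity.
have del : ref (V m.+1 :: bead b m ++ [:: V m.+1]) (bead b m.+1).
  by rewrite -> (bead_slide_rev Y b m _), (cancelV Y m.+1 [::]); rewrite cats0; reflexivity.
have him : i.+2 <= m.+1 by rewrite /m; lia.
split.
- transitivity (bead a i ++ V m.+1 :: bead b m ++ [:: V m.+1]).
    by rewrite <- ins; reflexivity.
  rewrite -> (bead_right Y a (Kcross Virtual) _ him), (catA (bead a i)), h1.
  rewrite -catA; rewrite -> (bead_right Y a (Kcross Virtual) [::] him); rewrite cats0.
  have := ref_app (bead a i) del; rewrite /= -catA; exact.
- transitivity ((V m.+1 :: bead b m ++ [:: V m.+1]) ++ bead a i).
    by rewrite <- ins; reflexivity.
  rewrite /= -catA -[bead a i]cats0 /=.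
  rewrite -> (bead_right_rev Y a (Kcross Virtual) [::] him), (catA (bead b m)), h2.
  rewrite -catA; rewrite -> (bead_right_rev Y a (Kcross Virtual) _ him).
  by rewrite -> del; rewrite cats0; reflexivity.
Qed.

End CrossBeads.

(** * Normal forms of virtual diagrams *)

(* An arc whose legs end at positions [i] and [i + k + 1]. *)
Fact arc_key : unit. Proof. exact: tt. Qed.
Definition arc i k a : word := locked_with arc_key (U i a :: mvr i.+1 k).

Lemma arcE i k a : arc i k a = U i a :: mvr i.+1 k.
Proof. exact: unlock. Qed.

(** The left leg of the base is x; [0 < i] keeps it in position 0. The index is the number of
    strands on top. *)
Inductive normal (b : bool) : word -> nat -> Prop :=
  | Normal_base : normal b [:: U 0 b] 2
  | Normal_arc N m i k a of normal b N m & 0 < i & i + k <= m :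
      normal b (N ++ arc i k a) m.+2.

Lemma wsize_arc i k a m : i + k <= m -> wsize m (arc i k a) = Some m.+2.
Proof.
move=> h; rewrite arcE /= addn0 ifT; last lia.
rewrite subn0 addn2; case: k h => [|k] h //; rewrite wsize_mvr // ifT //; lia.
Qed.

Lemma capless_mvr i k : capless (mvr i k).
Proof. by apply: (@inX_capless i (i + k).+1); apply: inX_mvr. Qed.

Lemma normal_wsize b N m : normal b N m -> capless N /\ wsize 0 N = Some m.
Proof.
elim=> {N m} // N m i k a _ [h1 h2] hi hk.
by rewrite capless_cat h1 wsize_cat h2 /= wsize_arc // arcE capless_cons capless_mvr.
Qed.

Lemma normal_ok b N m : normal b N m -> ok [::] N /\ size (tgt [::] N) = m.
Proof.
move=> /normal_wsize[h1 h2]; have h : ok [::] N by rewrite ok_capless ?h2.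
by split=> //; have := ok_wsize h; rewrite h2 => -[].
Qed.

Lemma normal_ge2 b N m : normal b N m -> 1 < m.
Proof. by case=> // *; lia. Qed.

(** * One event above a single arc *)

Section Arcs.
Context (Y : xmove).
Notation ref := (ref Y).
Notation refs := (refs Y).

Lemma exch_c' n m K L m' r : n + ktgt K <= m -> m' + ktgt K = m + ksrc K ->
  ref ((n, K) :: (m, L) :: r) ((m', L) :: (n, K) :: r).
Proof. by move=> h1 h2; apply: exch_c => //; lia. Qed.
Lemma exch_rev_c' n m K L m' r : n + ksrc K <= m -> m' + ksrc K = m + ktgt K ->
  ref ((m, L) :: (n, K) :: r) ((n, K) :: (m', L) :: r).
Proof. by move=> h1 h2; apply: exch_rev_c => //; lia. Qed.

Lemma arc_event_left i k a p K i' : p + ksrc K <= i -> i' + ksrc K = i + ktgt K ->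
  ref (arc i k a ++ [:: (p, K)]) ((p, K) :: arc i' k a).
Proof.
move=> h1 h2; rewrite !arcE /=.
have [w hw] : exists w, mvr i.+1 k = shift (ksrc K) w /\ mvr i'.+1 k = shift (ktgt K) w
    /\ inX p (i + k).+2 w.
  exists (mvr (i.+1 - ksrc K) k); rewrite !shift_mvr; split; first by congr mvr; lia.
  by split; [congr mvr; lia | apply: inX_mvr; lia].
case: hw => -> [-> hw]; rewrite -> (pass_right_rev Y K hw (leqnn p)).
by rewrite -> (@exch_rev_c' p _ K _ i'); [reflexivity|..].
Qed.

Lemma arc_event_right i k a p K : i + k <= p ->
  ref (arc i k a ++ [:: (p.+2, K)]) ((p, K) :: arc i k a).
Proof.
move=> h; rewrite !arcE /=.
have hw : inX i.+1 (i + k).+2 (mvr i.+1 k) by apply: inX_mvr; lia.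
rewrite -> (pass_left Y K hw); last lia.
by rewrite -> (@exch_c' i _ (Kcup a) _ p); [reflexivity|simpl; lia..].
Qed.

Lemma arc_cross_mid i k a p : i <= p -> p.+1 < i + k ->
  ref (arc i k a ++ [:: V p.+1]) (V p :: arc i k a).
Proof.
move=> h1 h2; rewrite !arcE /=.
have [_ h] := @mvr_cross Y p.+2 Virtual i.+1 k ltac:(lia) ltac:(lia).
rewrite -> h; rewrite -> (@exch_c' i _ (Kcup a) _ p); [reflexivity|simpl; lia..].
Qed.

Lemma arc_cap_mid i k a p : i <= p -> p <= i + k ->
  ref (arc i k.+2 a ++ [:: A p.+1]) (A p :: arc i k a).
Proof.
move=> h1 h2; rewrite !arcE /=.
have := @mvr_cap Y p.+1 i.+1 k [::] ltac:(lia) ltac:(lia); rewrite cats0 => h.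
rewrite -> h; rewrite -> (@exch_c' i _ (Kcup a) _ p); [reflexivity|simpl; lia..].
Qed.

Lemma arc_cross_out_left i k a : 0 < i ->
  ref (arc i k a ++ [:: V i.-1]) (arc i.-1 k.+1 a).
Proof.
case: i => // i _; rewrite !arcE mvrS' /=.
have hw : inX i.+2 (i + k).+3 (mvr i.+2 k) by apply: inX_mvr; lia.
rewrite -> (proj2 (pass_cross Y Virtual hw (leqnn _))).
by rewrite -> (cup_slide_c Y i Virtual); reflexivity.
Qed.

Lemma arc_cross_in_left i k a :
  ref (arc i k.+1 a ++ [:: V i]) (arc i.+1 k a).
Proof.
rewrite !arcE mvrS' /=.
have hw : inX i.+2 (i + k).+3 (mvr i.+2 k) by apply: inX_mvr; lia.
rewrite -> (proj2 (pass_cross Y Virtual hw (leqnn _))).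
by rewrite -> (cup_slide_rev_c Y i Virtual), (cancelV Y i); reflexivity.
Qed.

Lemma arc_cross_legs i a : ref (arc i 0 a ++ [:: V i]) (arc i 0 (~~ a)).
Proof. by rewrite !arcE; exact: kink_cup. Qed.

Lemma arc_cross_out_right i k a : ref (arc i k a ++ [:: V (i + k).+1]) (arc i k.+1 a).
Proof. by rewrite !arcE mvrS addSn; reflexivity. Qed.

Lemma arc_cross_in_right i k a : ref (arc i k.+1 a ++ [:: V (i + k).+1]) (arc i k a).
Proof.
rewrite !arcE mvrS /= -catA addSn /=; rewrite -> (cancelV Y _ [::]).
by rewrite cats0; reflexivity.
Qed.

(** Pulled tight, the strand joined to the left leg takes the place of the right leg, travelling
    across the [k] strands under the arc. A maximum on the right leg gives [mvl] in the same way. *)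
Lemma arc_cap_left i k a : 0 < i -> ref (arc i k a ++ [:: A i.-1]) (mvr i.-1 k).
Proof.
case: i => // i _; rewrite !arcE /=.
have hw : inX i (i + k).+1 (mvr i k) by apply: inX_mvr; lia.
rewrite -[i.+2]/(2 + i) -shift_mvr; rewrite -> (pass_cap Y [::] hw (leqnn i)).
by rewrite cats0; exact (ref_app (mvr i k) (zigzag_r Y i a)).
Qed.

Lemma arc_cap_in_left i k a : ref (arc i k.+1 a ++ [:: A i]) (mvr i k).
Proof.
rewrite !arcE mvrS' /=.
have hw : inX i (i + k).+1 (mvr i k) by apply: inX_mvr; lia.
rewrite -[i.+2]/(2 + i) -shift_mvr; rewrite -> (pass_cap Y [::] hw (leqnn i)).
by rewrite cats0; exact (ref_app (mvr i k) (reidemeister1_l Y i Virtual a)).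
Qed.

Lemma arc_cap_right i k a : ref (arc i k a ++ [:: A (i + k).+1]) (mvl i k).
Proof.
rewrite arcE; elim: k => [|k IH].
  by rewrite addn0; exact: zigzag_l.
rewrite mvrS mvlS /= -catA addSn addnS /= in IH *.
rewrite -> (cap_slide_c Y _ Virtual).
have hw : inX i.+1 (i + k).+2 (mvr i.+1 k) by apply: inX_mvr; lia.
rewrite -> (pass_left_c Y _ _ hw) => //.
by rewrite -> (@exch_c' i _ (Kcup a) _ (i + k)), IH; [reflexivity|simpl; lia..].
Qed.

Lemma arc_cap_in_right i k a : ref (arc i k.+1 a ++ [:: A (i + k).+1]) (mvl i k).
Proof.
rewrite !arcE mvrS /= -catA addSn /=; rewrite -> (kink_cap Y (i + k).+1 Virtual).
by have := arc_cap_right i k a; rewrite arcE.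
Qed.

End Arcs.

(** * Two-colourings above an arc *)

Lemma gcoutX p x y w c : gcout (X (size p) c) (p ++ x :: y :: w) = [:: p ++ y :: x :: w].
Proof. exact: (@gcout_cat (Kcross c) p [:: x; y] w erefl). Qed.

Lemma cout_mvr p x u w :
  cout (mvr (size p) (size u)) (p ++ x :: u ++ w) = [:: p ++ u ++ x :: w].
Proof.
elim: u p => [|y u IH] p; first by [].
rewrite mvrS' [cout _ _]/= gcoutX /= cats0.
by have := IH (rcons p y); rewrite size_rcons -!cats1 -!catA.
Qed.

Lemma cout_arc i k a m c : i + k <= size m ->
  take i m ++ c :: take k (drop i m) ++ c :: drop (i + k) m \in cout (arc i k a) m.
Proof.
move=> h; have hi : size (take i m) = i by rewrite size_takel //; lia.
have hk : size (take k (drop i m)) = k by rewrite size_takel // size_drop; lia.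
rewrite arcE /=; apply/flatten_mapP; exists (take i m ++ [:: c; c] ++ drop i m).
  have := @gcout_cat (Kcup a) (take i m) [::] (drop i m) erefl; rewrite hi /= cat_take_drop => ->.
  by case: (c); rewrite !inE eqxx ?orbT.
have := cout_mvr (rcons (take i m) c) c (take k (drop i m)) (drop (i + k) m).
rewrite size_rcons hi hk -!cats1 -!catA /= addnC -drop_drop cat_take_drop => ->.
by rewrite inE.
Qed.

(* Position above an arc [i, k] of the strand at position [p] below it. *)
Definition over_arc i k p := if p < i then p else if p < i + k then p.+1 else p.+2.

Lemma over_arc_cases i k p : [\/ p = i, p = (i + k).+1 | exists2 q, p = over_arc i k q &
  (q < p.+1) && (p <= q.+2)].
Proof.
rewrite /over_arc; case: (ltngtP p i) => [h|h|->]; last by constructor 1.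
  by constructor 3; exists p; rewrite ?h; lia.
case: (ltngtP p (i + k).+1) => [h'|h'|->]; last by constructor 2.
  by constructor 3; exists p.-1; [rewrite ifF ?ifT; lia | lia].
by constructor 3; exists p.-2; [rewrite !ifF; lia | lia].
Qed.

Lemma nth_over_arc i k (m : seq bool) c (L := take i m ++ c :: take k (drop i m) ++ c :: drop (i + k) m) :
  i + k <= size m ->
  [/\ forall p, nth false L (over_arc i k p) = nth false m p, nth false L i = c
    & nth false L (i + k).+1 = c].
Proof.
move=> h; have hi : size (take i m) = i by rewrite size_takel //; lia.
have hk : size (take k (drop i m)) = k by rewrite size_takel // size_drop; lia.
split.
- move=> p; rewrite /L /over_arc; case: ltnP => h1; first by rewrite nth_cat hi h1 nth_take.
  case: ltnP => h2.
    rewrite nth_cat hi ifF; last lia.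
    by rewrite subSn //= nth_cat hk ifT ?nth_take ?nth_drop ?subnKC //; lia.
  rewrite nth_cat hi ifF; last lia.
  rewrite -addn2 -addnBAC // addn2 /= nth_cat hk ifF; last lia.
  by rewrite subSn /= ?nth_drop; [congr nth; lia | lia].
- by rewrite nth_cat hi ltnn subnn.
- rewrite nth_cat hi ifF; last lia.
  by rewrite subSn /= ?nth_cat ?hk; [rewrite ifF ?addKn ?subnn //; lia | lia].
Qed.

(* The strands [p] and [q] above the word [N] lie on one arc, alone. *)
Definition paired (N : word) m p q := exists2 M, M \in cout N [::] &
  forall r, r < m -> nth false M r = (r == p) || (r == q).

Lemma cout_false b N m : normal b N m -> nseq m false \in cout N [::].
Proof.
elim=> {N m} [|N m i k a _ IH hi hk]; first by rewrite !inE.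
apply/cout_cat; exists (nseq m false) => //.
have := @cout_arc i k a (nseq m false) false; rewrite size_nseq => /(_ hk).
rewrite !(take_nseq, drop_nseq); try lia.
set L := (X in X \in _ -> _); suff -> : nseq m.+2 false = L by [].
have /all_pred1P-> : all (pred1 false) L by rewrite /L all_cat /= all_cat /= !all_nseq !orbT.
by congr nseq; rewrite /L size_cat /= size_cat /= !size_nseq; lia.
Qed.

Lemma paired_top b N m i k a : normal b N m -> i + k <= m ->
  paired (N ++ arc i k a) m.+2 i (i + k).+1.
Proof.
move=> hN hk; have h0 := cout_false hN.
have hs : i + k <= size (nseq m false) by rewrite size_nseq.
exists (take i (nseq m false) ++ true :: take k (drop i (nseq m false)) ++ true :: drop (i + k) (nseq m false)).
  by apply/cout_cat; exists (nseq m false) => //; apply: cout_arc.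
have [h1 h2 h3] := nth_over_arc true hs.
move=> r hr; case: (over_arc_cases i k r) => [->|->|[q -> /andP[hq hq']]].
- by rewrite h2 eqxx.
- by rewrite h3 eqxx orbT.
- rewrite h1 nth_nseq if_same; symmetry; apply/negbTE; rewrite /over_arc.
  by case: ltnP => ?; [|case: ltnP => ?]; lia.
Qed.

Lemma paired_lift b N m i k a p q : normal b N m -> i + k <= m -> paired N m p q ->
  paired (N ++ arc i k a) m.+2 (over_arc i k p) (over_arc i k q).
Proof.
move=> hN hk [M hM hr]; have hs : size M = m.
  by apply: size_cout hM; case: (normal_wsize hN).
rewrite -hs in hk hr *; have [h1 h2 h3] := nth_over_arc false hk.
exists (take i M ++ false :: take k (drop i M) ++ false :: drop (i + k) M).
  by apply/cout_cat; exists M => //; apply: cout_arc.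
move=> r hr'; case: (over_arc_cases i k r) hr' => [->|->|[j -> _]] hr'.
- rewrite h2; symmetry; apply/negbTE; rewrite /over_arc.
  by case: ltnP => ?; [|case: ltnP => ?]; (case: ltnP => ?; [|case: ltnP => ?]); lia.
- rewrite h3; symmetry; apply/negbTE; rewrite /over_arc.
  by case: ltnP => ?; [|case: ltnP => ?]; (case: ltnP => ?; [|case: ltnP => ?]); lia.
- have inj x : (over_arc i k j == over_arc i k x) = (j == x).
    rewrite /over_arc; case: (ltnP j i) => ?; [|case: (ltnP j (i + k)) => ?];
    (case: (ltnP x i) => ?; [|case: (ltnP x (i + k)) => ?]); lia.
  rewrite h1 !inj; apply: hr.
  by move: hr' hk; rewrite /over_arc; case: (ltnP j i) => ?; [|case: (ltnP j (i + k)) => ?]; lia.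
Qed.

(** * Events and beads above a normal form *)

Section Normal.
Context (Y : xmove) (b : bool).
Notation ref := (ref Y).
Notation refs := (refs Y).
Notation normal := (normal b).

Lemma refs_ref s w w' : ref w w' -> refs s w w'.
Proof. by case. Qed.

Lemma ref_pre w r r' : ref r r' -> ref (w ++ r) (w ++ r').
Proof. by move=> h; rewrite -> h; reflexivity. Qed.

(** Induction on the arcs, from the top. A crossing that involves a leg of the last arc only changes
    its parameters; any other crossing slides below this arc. *)
Lemma normal_cross N m p : normal N m -> 0 < p -> p.+1 < m ->
  exists2 N', normal N' m & refs [::] (N ++ [:: V p]) N'.
Proof.
move=> hN; elim: hN p => {N m} [|N m i k a hN IH hi hk] p hp hpm; first lia.
have top i' k' a' : ref (arc i k a ++ [:: V p]) (arc i' k' a') -> 0 < i' -> i' + k' <= m ->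
    exists2 N', normal N' m.+2 & refs [::] ((N ++ arc i k a) ++ [:: V p]) N'.
  move=> h h1 h2; exists (N ++ arc i' k' a'); first exact: Normal_arc.
  by rewrite -catA; apply: refs_ref; apply: ref_pre.
have down p' : ref (arc i k a ++ [:: V p]) (V p' :: arc i k a) -> 0 < p' -> p'.+1 < m ->
    exists2 N', normal N' m.+2 & refs [::] ((N ++ arc i k a) ++ [:: V p]) N'.
  move=> h h1 h2; have [N' hN' e] := IH p' h1 h2.
  exists (N' ++ arc i k a); first exact: Normal_arc.
  rewrite -catA; transitivity (N ++ V p' :: arc i k a).
    by apply: refs_ref; apply: ref_pre.
  by have := refs_app (arc i k a) e; rewrite -catA.
case: (ltngtP p.+1 i) => h1.
- by apply: (down p) => //; [apply: arc_event_left => /=; lia | lia].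
- case: (ltngtP p i) => h2; first lia.
  + case: (ltngtP p (i + k)) => h3.
    * case: p hp hpm h1 h2 h3 top down => // p hp hpm h1 h2 h3 top down.
      by apply: (down p); [apply: arc_cross_mid => //; lia | lia | lia].
    * case: (ltngtP p (i + k).+1) => h4; first lia.
        case: p hp hpm h1 h2 h3 h4 top down => [|[|p]] hp hpm h1 h2 h3 h4 top down; [lia|lia|].
        by apply: (down p); [apply: arc_event_right => //; lia | lia | lia].
      apply: (top i k.+1 a) => //; last lia.
      by rewrite h4; exact: arc_cross_out_right.
    * case: k hk h3 top down {h1} => [|k] hk h3 top down; first lia.
      apply: (top i k a) => //; last lia.
      by rewrite h3 addnS; exact: arc_cross_in_right.
  + case: k hk top down => [|k] hk top down.
      by apply: (top i 0 (~~ a)) => //; rewrite h2; exact: arc_cross_legs.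
    by apply: (top i.+1 k a); [rewrite h2; exact: arc_cross_in_left | | lia].
- apply: (top i.-1 k.+1 a); [|lia|lia].
  by rewrite (_ : p = i.-1); [exact: arc_cross_out_left | lia].
Qed.

Lemma normal_crosses N m l : normal N m -> all (fun p => (0 < p) && (p.+1 < m)) l ->
  exists2 N', normal N' m & refs [::] (N ++ [seq V p | p <- l]) N'.
Proof.
elim: l N => [|p l IH] N hN /=; first by exists N; rewrite ?cats0; [|reflexivity].
case/andP=> /andP[hp hpm] /IH{}IH; have [N1 /IH[N' hN' e'] e] := normal_cross hN hp hpm.
exists N' => //; transitivity (N1 ++ [seq V p | p <- l]); last exact: e'.
by have := refs_app [seq V p | p <- l] e; rewrite -catA.
Qed.

Lemma normal_mvr N m i k : normal N m -> 0 < i -> i + k < m ->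
  exists2 N', normal N' m & refs [::] (N ++ mvr i k) N'.
Proof.
move=> hN hi hk; apply: normal_crosses hN _; apply/allP=> p.
by rewrite mem_iota; lia.
Qed.

Lemma normal_mvl N m i k : normal N m -> 0 < i -> i + k < m ->
  exists2 N', normal N' m & refs [::] (N ++ mvl i k) N'.
Proof.
move=> hN hi hk; rewrite /mvl /mvr -map_rev; apply: normal_crosses hN _.
by rewrite all_rev; apply/allP=> p; rewrite mem_iota; lia.
Qed.

(** A maximum at one leg of the last arc straightens this arc to a virtual trip of the other strand,
    absorbed by [normal_crosses]; a maximum away from the legs slides below the arc. *)
Lemma normal_cap N m p : normal N m -> 0 < p -> p.+1 < m -> ok [::] (N ++ [:: A p]) ->
  ~ paired N m p p.+1 ->
  exists2 N', normal N' m.-2 & refs [::] (N ++ [:: A p]) N'.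
Proof.
move=> hN; elim: hN p => {N m} [|N m i k a hN IH hi hk] p hp hpm hok hpair; first lia.
have m2 := normal_ge2 hN.
have down p' i' k' : ref (arc i k a ++ [:: A p]) (A p' :: arc i' k' a) ->
    0 < p' -> p'.+1 < m -> over_arc i k p' = p -> over_arc i k p'.+1 = p.+1 ->
    0 < i' -> i' + k' <= m.-2 ->
    exists2 N', normal N' m.+2.-2 & refs [::] ((N ++ arc i k a) ++ [:: A p]) N'.
  move=> h h1 h2 h3 h4 h5 h6.
  have e0 : refs [::] ((N ++ arc i k a) ++ [:: A p]) ((N ++ [:: A p']) ++ arc i' k' a).
    by rewrite -!catA; apply: refs_ref; apply: ref_pre.
  have [||N' hN' e] := IH p' h1 h2.
  - by have [+ _ _ _] := refsP e0 hok; rewrite ok_cat => /andP[].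
  - by move=> /(paired_lift a hN hk); rewrite h3 h4.
  exists (N' ++ arc i' k' a).
    by have := Normal_arc a hN' h5 h6; rewrite /= (_ : m.-2.+2 = m) //; lia.
  by transitivity ((N ++ [:: A p']) ++ arc i' k' a) => //; apply: refs_app.
have done w : ref (arc i k a ++ [:: A p]) w ->
    (exists2 N', normal N' m & refs [::] (N ++ w) N') ->
    exists2 N', normal N' m.+2.-2 & refs [::] ((N ++ arc i k a) ++ [:: A p]) N'.
  move=> h [N' hN' e]; exists N' => //; rewrite -catA; transitivity (N ++ w) => //.
  by apply: refs_ref; apply: ref_pre.
have overE q : over_arc i k q = if q < i then q else if q < i + k then q.+1 else q.+2 by [].
clear IH hok; case: (ltngtP p.+1 i) => h1.
- apply: (down p i.-2 k); rewrite ?overE ?h1 //; try lia.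
    by apply: arc_event_left => /=; lia.
  by rewrite ifT //; lia.
- case: (ltngtP p i) => h2; first lia.
  + case: (ltngtP p (i + k)) => h3.
    * case: p hp hpm h1 h2 h3 hpair down done overE => // p hp hpm h1 h2 h3 hpair down _ overE.
      case: k hk h3 hpair down overE => [|[|k]] hk h3 hpair down overE; try lia.
      apply: (down p i k); rewrite ?overE; try lia; first by apply: arc_cap_mid; lia.
        by rewrite ifF ?ifT //; lia.
      by rewrite ifF ?ifT //; lia.
    * case: (ltngtP p (i + k).+1) => h4; first lia.
        case: p hp hpm h1 h2 h3 h4 hpair down done overE => [|[|p]] hp hpm h1 h2 h3 h4 hpair down _ overE; [lia|lia|].
        apply: (down p i k); rewrite ?overE; try lia; first by apply: arc_event_right; lia.
          by rewrite !ifF //; lia.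
        by rewrite !ifF //; lia.
      apply: (done (mvl i k)); first by rewrite h4; exact: arc_cap_right.
      by apply: normal_mvl => //; lia.
    * case: k hk h3 hpair down done overE {h1} => [|k] hk h3 hpair down done _; first lia.
      apply: (done (mvl i k)); first by rewrite h3 addnS; exact: arc_cap_in_right.
      by apply: normal_mvl => //; lia.
  + case: k hk hpair down done overE => [|k] hk hpair down done _.
      (* For [k = 0] and [p = i] the maximum would close the last arc, which is the excluded
         case. *)
      by case: hpair; have := paired_top a hN hk; rewrite addn0 h2.
    apply: (done (mvr i k)); first by rewrite h2; exact: arc_cap_in_left.
    by apply: normal_mvr => //; lia.
- apply: (done (mvr i.-1 k)); first by rewrite (_ : p = i.-1); [exact: arc_cap_left | lia].
  by apply: normal_mvr => //; lia.
Qed.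

Lemma bead_right_word t l w r : all (fun g : gen => l.+2 <= g.1) w ->
  ref (bead t l ++ w ++ r) (w ++ bead t l ++ r) /\
  ref (w ++ bead t l ++ r) (bead t l ++ w ++ r).
Proof.
elim: w => [_|[n K] w IH] /=; first by split; reflexivity.
case/andP=> hn /IH[h1 h2]; split.
  by rewrite -> (bead_right Y t K _ hn), h1; reflexivity.
by rewrite -> h2, (bead_right_rev Y t K _ hn); reflexivity.
Qed.

Lemma mvr_ge i k l : l <= i -> all (fun g : gen => l <= g.1) (mvr i k).
Proof.
by move=> h; rewrite /mvr all_map; apply/allP=> p; rewrite mem_iota /=; lia.
Qed.

Lemma bead_left_mvr t l i k r : 0 < i -> i + k <= l ->
  ref (bead t l ++ mvr i k ++ r) (mvr i k ++ bead t l ++ r) /\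
  ref (mvr i k ++ bead t l ++ r) (bead t l ++ mvr i k ++ r).
Proof.
elim: k i => [|k IH] i hi hk; first by split; reflexivity.
have [|h1 h2] := IH i.+1 isT; first lia.
have hil : i < l by lia.
have [h3 h4] := bead_left_cross Y t Virtual (mvr i.+1 k ++ r) hi hil.
rewrite mvrS' /=; split.
  by rewrite -> h4, h1; reflexivity.
by rewrite -> h2, h3; reflexivity.
Qed.

Lemma bead_along_mvr t i k r :
  ref (bead t i ++ mvr i.+1 k ++ r) (mvr i.+1 k ++ bead t (i + k) ++ r) /\
  ref (mvr i.+1 k ++ bead t (i + k) ++ r) (bead t i ++ mvr i.+1 k ++ r).
Proof.
elim: k i => [|k IH] i; first by rewrite addn0; split; reflexivity.
have [h1 h2] := IH i.+1; rewrite mvrS' -addSnnS /=; split.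
  by rewrite -> (bead_unslide Y t i _).1, h1; reflexivity.
by rewrite -> h2, (bead_unslide Y t i _).2; reflexivity.
Qed.

(* Beads are indexed by [p.-1], where [p > 0] is the position of their strand. *)
Lemma bead_arc t i k a p r : 0 < i -> 0 < p ->
  ref (arc i k a ++ bead t (over_arc i k p).-1 ++ r) (bead t p.-1 ++ arc i k a ++ r) /\
  ref (bead t p.-1 ++ arc i k a ++ r) (arc i k a ++ bead t (over_arc i k p).-1 ++ r).
Proof.
case: i => // i _; case: p => // p _; rewrite arcE /over_arc /= ltnS.
case: ltnP => h1 /=.
  have hw : all (fun g : gen => p.+2 <= g.1) (U i.+1 a :: mvr i.+2 k).
    by rewrite [all _ _]/= mvr_ge ?andbT //; lia.
  by have [h2 h3] := bead_right_word t r hw; split; [exact: h3 | exact: h2].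
rewrite addSn ltnS; case: ltnP => h2 /=.
  have -> : mvr i.+2 k = mvr i.+2 (p - i) ++ V p.+2 :: mvr p.+3 (i + k - p).-1.
    rewrite -mvrS'; have -> : (i + k - p).-1.+1 = i + k - p by lia.
    have -> : p.+2 = i.+2 + (p - i) by lia.
    by rewrite -mvrD; congr mvr; lia.
  rewrite -!catA /=.
  have [h3 h4] := @bead_right_word t p.+1 (mvr p.+3 (i + k - p).-1) r (mvr_ge _ (leqnn _)).
  have [|h5 h6] := @bead_left_mvr t p.+2 i.+2 (p - i) (V p.+2 :: mvr p.+3 (i + k - p).-1 ++ r) isT; first lia.
  split.
    by rewrite -> h4, (bead_slide_rev Y t p.+1 _), h6, (bead_left_cup Y t a _ h1).1; reflexivity.
  by rewrite -> (bead_left_cup Y t a _ h1).2, h5, (bead_slide Y t p.+1 _), h3; reflexivity.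
have [|h5 h6] := @bead_left_mvr t p.+2 i.+2 k r isT; first lia.
split.
  by rewrite -> h6, (bead_left_cup Y t a _ h1).1; reflexivity.
by rewrite -> (bead_left_cup Y t a _ h1).2, h5; reflexivity.
Qed.

(** The bead goes down one leg, changes type at the minimum, and goes up the other. *)
Lemma bead_leg t i k a : 0 < i ->
  ref (arc i k a ++ bead t i.-1) (arc i k a ++ bead (~~ t) (i + k)) /\
  ref (arc i k a ++ bead t (i + k)) (arc i k a ++ bead (~~ t) i.-1).
Proof.
case: i => // i _; rewrite arcE /= addSn.
have [h1 h2] := @bead_right_word t i (mvr i.+2 k) [::] (mvr_ge _ (leqnn _)).
have [h3 h4] := @bead_right_word (~~ t) i (mvr i.+2 k) [::] (mvr_ge _ (leqnn _)).
have [h5 h6] := bead_along_mvr t i.+1 k [::].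
have [h7 h8] := bead_along_mvr (~~ t) i.+1 k [::].
rewrite !cats0 in h1 h2 h3 h4 h5 h6 h7 h8; split.
  by rewrite -> h2, (bead_turn Y t i a _).2, h7; reflexivity.
by rewrite -> h6, (bead_turn Y t i a _).1, h3; reflexivity.
Qed.

Lemma paired_sym N m p q : paired N m p q -> paired N m q p.
Proof. by case=> M hM h; exists M => // r /h->; rewrite orbC. Qed.

Lemma over_arc_inj i k : injective (over_arc i k).
Proof.
move=> x j; rewrite /over_arc; case: (ltnP j i) => ?; [|case: (ltnP j (i + k)) => ?];
  (case: (ltnP x i) => ?; [|case: (ltnP x (i + k)) => ?]); lia.
Qed.

(** [q] is the other end of the arc ending at [p]. If [q = 0] the arc is the base, and the bead
    disappears at its minimum. *)
Lemma partner N m p : normal N m -> 0 < p -> p < m -> exists q,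
  [/\ q < m, q != p, paired N m p q & forall t, exists t',
      refs [::] (N ++ bead t p.-1) (if q == 0 then N else N ++ bead t' q.-1)].
Proof.
move=> hN; elim: hN p => {N m} [|N m i k a hN IH hi hk] p hp hpm.
  have -> : p = 1 by lia.
  exists 0; split=> // [|t]; first by exists [:: true; true] => // -[|[]].
  exists t; apply: refs_ref; have := bead_absorb Y t b [::]; rewrite cats0; exact.
case: (over_arc_cases i k p) => [pE|pE|[p0 pE hp0]].
- exists (i + k).+1; rewrite pE; split; [lia|lia|exact: (paired_top a hN hk)|move=> t].
  exists (~~ t); rewrite /= -!catA; apply: refs_ref; apply: ref_pre.
  exact: (bead_leg t k a hi).1.
- exists i; rewrite pE; split; [lia|lia|exact/paired_sym/(paired_top a hN hk)|move=> t].
  exists (~~ t); rewrite ifF; last by case: (i) hi.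
  by rewrite -!catA; apply: refs_ref; apply: ref_pre; exact: (bead_leg t k a hi).2.
- have p0_gt0 : 0 < p0 by case: p0 pE hp0 => // pE _; move: hp; rewrite pE /over_arc hi.
  have p0m : p0 < m.
    by move: hpm; rewrite pE /over_arc; case: (ltnP p0 i) => ?; [|case: (ltnP p0 (i + k)) => ?]; lia.
  have [q [hq qp hpq hb]] := IH p0 p0_gt0 p0m.
  exists (over_arc i k q); split.
  + by rewrite /over_arc; case: (ltnP q i) => ?; [|case: (ltnP q (i + k)) => ?]; lia.
  + by rewrite pE (inj_eq (@over_arc_inj i k)).
  + by rewrite pE; exact: paired_lift hN hk hpq.
  + move=> t; have [t' e] := hb t; exists t'.
    have -> : (over_arc i k q == 0) = (q == 0) by case: (q) => [|q']; rewrite /over_arc ?hi //; case: ifP => //; case: ifP.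
    transitivity ((N ++ bead t p0.-1) ++ arc i k a).
      rewrite pE -!catA; apply: refs_ref; apply: ref_pre.
      by have [h _] := bead_arc t k a [::] hi p0_gt0; move: h; rewrite !cats0.
    transitivity ((if q == 0 then N else N ++ bead t' q.-1) ++ arc i k a).
      exact: refs_app.
    case: eqP => [_|/eqP hq0]; first by reflexivity.
    rewrite -!catA; apply: refs_ref; apply: ref_pre.
    have q_gt0 : 0 < q by rewrite lt0n.
    by have [_ h] := bead_arc t' k a [::] hi q_gt0; move: h; rewrite !cats0.
Qed.
End Normal.

(** * Beaded normal forms, one event at a time *)

Definition beads (z : seq (bool * nat)) : word := flatten [seq bead x.1 x.2 | x <- z].

Lemma beads_cons x z : beads (x :: z) = bead x.1 x.2 ++ beads z.
Proof. by []. Qed.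
Lemma beads_cat z z' : beads (z ++ z') = beads z ++ beads z'.
Proof. by rewrite /beads map_cat flatten_cat. Qed.

(* The strand [x.2.+1] of every bead [x] exists on a line of [m] strands. *)
Definition fits m := all (fun x : bool * nat => x.2.+1 < m).

Lemma tgt_beads s z : fits (size s) z -> tgt s (beads z) = s.
Proof.
elim: z => [|x z IH] //= /andP[h /IH e].
by rewrite beads_cons tgt_cat tgt_bead.
Qed.

Lemma cout_inX lo hi w m : inX lo hi w -> hi <= size m -> cout w m = [:: tgt m w].
Proof.
elim: w m => [|[n [a||c]] w IH] m //= /andP[/andP[_ hn] hw] hm.
have /window[u [s0 [v [mE hu]]]] : n + 2 <= size m by rewrite addn2; lia.
case: s0 mE => [|x [|y []]] // mE _.
have [hg gE] := gX_cat c u x y v; rewrite hu -[u ++ _]/(u ++ [:: x; y] ++ v) -mE in hg gE.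
have -> : gcout (n, Kcross c) m = [:: gtgt m (n, Kcross c)] by rewrite gE {1}mE -{1}hu gcoutX.
rewrite /= cats0; apply: IH => //; rewrite size_gtgt //= subnK //; lia.
Qed.

Lemma cout_beads z m : fits (size m) z -> m \in cout (beads z) m.
Proof.
elim: z => [|x z IH]; first by rewrite inE.
move=> /= /andP[h /IH hz]; rewrite beads_cons; apply/cout_cat; exists m => //.
by rewrite (cout_inX (inX_bead x.1 x.2) h) tgt_bead // inE.
Qed.

Section Process.
Context (Y : xmove) (b : bool).
Notation ref := (ref Y).
Notation refs := (refs Y).

Lemma beads_push (P Q : pred nat) g z r :
  (forall t l r, P l -> exists t' l', Q l' /\ ref (bead t l ++ g :: r) (g :: bead t' l' ++ r)) ->
  all (fun x => P x.2) z ->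
  exists z', all (fun x => Q x.2) z' /\ ref (beads z ++ g :: r) (g :: beads z' ++ r).
Proof.
move=> h; elim: z => [_|[t l] z IH] /=; first by exists [::]; split=> //; reflexivity.
case/andP=> /(h t) {}h /IH[z' [hz' e]]; rewrite beads_cons -catA.
have [t' [l' [hl' e']]] := h (beads z' ++ r).
exists ((t', l') :: z'); rewrite /= hl' hz'; split=> //.
by rewrite beads_cons -catA; rewrite -> e, e'; reflexivity.
Qed.

Lemma beads_cup m n a z r : 0 < n -> fits m z -> exists z',
  fits m.+2 z' /\ ref (beads z ++ U n a :: r) (U n a :: beads z' ++ r).
Proof.
move=> hn hz.
apply: (@beads_push (fun l => l.+1 < m) (fun l => l.+1 < m.+2)) => [t l r' hl|//]; exists t.
case: (leqP l.+2 n) => h.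
  by exists l; split; [lia | exact: bead_right].
exists l.+2; split; first lia.
by case: n hn h => // n _ h; exact: (bead_left_cup Y t a r' (_ : n <= l)).2.
Qed.

Lemma beads_cross m n z r : 0 < n -> n.+1 < m -> fits m z -> exists z',
  fits m z' /\ ref (beads z ++ V n :: r) (V n :: beads z' ++ r).
Proof.
move=> hn hm hz.
apply: (@beads_push (fun l => l.+1 < m) (fun l => l.+1 < m)) => [t l r' hl|//]; exists t.
case: (leqP l.+2 n) => h.
  by exists l; split; [|exact: bead_right].
case: n hn hm h => // n _ hm h; case: (ltngtP l n) => h1; first lia.
  case: (ltngtP l n.+1) => h2; first lia.
    by exists l; split=> //; exact: (bead_left_cross Y t Virtual r' (ltn0Sn n) h2).2.
  by exists n; split; [lia | rewrite h2; exact: bead_slide].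
by exists n.+1; split; [lia | rewrite h1; exact: (bead_unslide Y t n r').1].
Qed.

(** Bead indices are one less than positions: the excluded indices [n.-1] and [n] are those of the
    two strands that meet at the maximum. *)
Lemma beads_cap m n z r : 0 < n -> n.+1 < m -> fits m z ->
  all (fun x : bool * nat => (x.2.+1 != n) && (x.2 != n)) z -> exists z',
  fits m.-2 z' /\ ref (beads z ++ A n :: r) (A n :: beads z' ++ r).
Proof.
move=> hn hm hz1 hz2.
apply: (@beads_push (fun l => [&& l.+1 < m, l.+1 != n & l != n]) (fun l => l.+1 < m.-2)) => [t l r' /and3P[h1 h2 h3]|].
  exists t; case: (leqP l.+2 n) => h; first by exists l; split; [lia | exact: bead_right].
  case: n hn hm h h2 h3 {hz2} => // n _ hm h h2 h3; case: l h1 h h2 h3 => [|[|l]] h1 h h2 h3; try lia.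
  by exists l; split; [lia | apply: bead_left_cap; lia].
by elim: z hz1 hz2 => //= x z IH /andP[-> /IH h] /andP[-> /h].
Qed.

Lemma beads_comm t l z r : all (fun x : bool * nat => x.2 != l) z ->
  ref (beads z ++ bead t l ++ r) (bead t l ++ beads z ++ r).
Proof.
elim: z => [_|[t' l'] z IH] /=; first by reflexivity.
case/andP=> h /IH e; rewrite beads_cons -!catA.
by rewrite -> e, (bead_comm Y t' t _ h); reflexivity.
Qed.

(** A bead on one of the two strands commutes down past the beads already cleared, which avoid its
    strand, and moves to the other end of its arc. That end is neither [p] nor [p.+1], as these
    strands are not paired. *)
Lemma beads_clear N m p z : normal b N m -> 0 < p -> p.+1 < m -> ~ paired N m p p.+1 ->
  fits m z -> exists z', [/\ fits m z',
    all (fun x : bool * nat => (x.2.+1 != p) && (x.2 != p)) z' &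
    refs [::] (N ++ beads z) (N ++ beads z')].
Proof.
move=> hN hp hpm hpair; elim/last_ind: z => [_|z [t l] IH].
  by exists [::]; split=> //; reflexivity.
rewrite /fits all_rcons /= => /andP[hl /IH[z' [h1 h2 e]]].
rewrite -cats1 beads_cat catA.
have {}e : refs [::] ((N ++ beads z) ++ bead t l) ((N ++ beads z') ++ bead t l).
  exact: refs_app.
have unit x : beads [:: x] = bead x.1 x.2 by rewrite /beads /= cats0.
rewrite unit /=; case hlp : ((l.+1 != p) && (l != p)).
  exists (rcons z' (t, l)); split; first by rewrite /fits all_rcons /= hl.
    by rewrite all_rcons /= hlp.
  by rewrite -cats1 beads_cat catA unit.
have down : refs [::] ((N ++ beads z') ++ bead t l) ((N ++ bead t l) ++ beads z').
  rewrite -!catA; apply: refs_ref; apply: ref_pre.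
  have := @beads_comm t l z' [::]; rewrite !cats0; apply.
  apply: sub_all h2 => -[t' l'] /= h; lia.
have [q [hq qp hpq hb]] := partner Y hN (isT : 0 < l.+1) hl.
have [t' /= e'] := hb t.
have hqp : (q != p) && (q != p.+1).
  have [lp|lp] : l.+1 = p \/ l = p by lia.
    rewrite lp in hpq qp; rewrite qp; apply/eqP => qE; apply: hpair; by rewrite -qE.
  rewrite lp in hpq qp; rewrite qp andbT; apply/eqP => qE; apply: hpair.
  by apply: paired_sym; rewrite -qE in hpq *.
have fin : refs [::] ((N ++ beads z) ++ bead t l) ((if q == 0 then N else N ++ bead t' q.-1) ++ beads z').
  transitivity ((N ++ beads z') ++ bead t l) => //.
  transitivity ((N ++ bead t l) ++ beads z') => //.
  exact: refs_app.
case: q hq qp hpq {hb e'} hqp fin => [|q] /= hq qp hpq hqp fin; first by exists z'.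
exists ((t', q) :: z'); split; first by rewrite /fits /= hq.
  by rewrite /= h2 andbT; lia.
by rewrite beads_cons catA.
Qed.

Lemma refs_tgt s w w' : refs s w w' -> ok s w -> ok s w' /\ tgt s w' = tgt s w.
Proof. by move=> [h] /h[]. Qed.

Definition beaded (w : word) := exists N m z, [/\ normal b N m, fits m z & refs [::] w (N ++ beads z)].

Lemma beaded_step w g : beaded w -> 0 < g.1 -> ok [::] (w ++ [:: g]) ->
  (g.2 = Kcap -> ~ paired w (size (tgt [::] w)) g.1 g.1.+1) -> beaded (w ++ [:: g]).
Proof.
case=> N [m [z [hN hz e]]] hg hok hpair.
have okw : ok [::] w by move: hok; rewrite ok_cat => /andP[].
have [okN sN] := normal_ok hN; have [okNz tNz] := refs_tgt e okw.
have tw : tgt [::] w = tgt [::] N by rewrite -tNz tgt_cat tgt_beads // sN.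
rewrite tw sN in hpair.
have {}hpair : g.2 = Kcap -> ~ paired N m g.1 g.1.+1.
  (* A pairing in [N] is one in [w]: beads keep every colouring of the strands, and rewriting
     preserves colourings. *)
  move=> /hpair h [M hM hr]; apply: h; exists M => //.
  have [_ _ _ ->] := refsP e okw; last by [].
  apply/cout_cat; exists M => //; apply: cout_beads.
  by rewrite (@size_cout N [::] M m) //; exact: (normal_wsize hN).2.
have {}e r : refs [::] (w ++ r) (N ++ beads z ++ r).
  by rewrite catA; exact: refs_app.
have hgok : gok (tgt [::] N) g by move: hok; rewrite ok_cat tw /= andbT => /andP[].
case: g hg hok hpair hgok => p [a||c] /= hp hok hpair hgok.
- have hpm : p <= m by move: hgok => /andP[]; rewrite /= addn0 sN.
  have [z' [hz' e']] := beads_cup a [::] hp hz; rewrite cats0 in e'.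
  exists (N ++ arc p 0 a), m.+2, z'; split=> //; first by apply: Normal_arc; rewrite ?addn0.
  transitivity (N ++ beads z ++ [:: U p a]) => //.
  by rewrite arcE -catA; apply: refs_ref; apply: ref_pre; exact: e'.
- have hpm : p.+1 < m by move: hgok => /andP[]; rewrite /= addn2 sN.
  have {}hpair := hpair erefl.
  have [z1 [h1 h2 e1]] := beads_clear hN hp hpm hpair hz.
  have [z' [hz' e']] := beads_cap [::] hp hpm h1 h2; rewrite cats0 in e'.
  have e2 : refs [::] (w ++ [:: A p]) ((N ++ [:: A p]) ++ beads z').
    transitivity ((N ++ beads z) ++ [:: A p]); first by rewrite -catA.
    transitivity ((N ++ beads z1) ++ [:: A p]); first exact: refs_app.
    by rewrite -!catA; apply: refs_ref; apply: ref_pre.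
  have okA : ok [::] (N ++ [:: A p]).
    by have [+ _] := refs_tgt e2 hok; rewrite ok_cat => /andP[].
  have [N' hN' eN] := normal_cap Y hN hp hpm okA hpair.
  exists N', m.-2, z'; split=> //.
  by transitivity ((N ++ [:: A p]) ++ beads z') => //; exact: refs_app.
- have hpm : p.+1 < m by move: hgok => /andP[]; rewrite /= addn2 sN.
  (* [z0] holds the beads created by the crossing itself: none if it is virtual, two if it is
     real. *)
  have virtual z0 : fits m z0 -> refs [::] (w ++ [:: X p c]) (N ++ beads z ++ V p :: beads z0) ->
      beaded (w ++ [:: X p c]).
    move=> hz0 e0; have [z' [hz' e']] := beads_cross (beads z0) hp hpm hz.
    have [N' hN' eN] := normal_cross Y hN hp hpm.
    exists N', m, (z' ++ z0); split=> //; first by rewrite /fits all_cat; apply/andP.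
    transitivity (N ++ beads z ++ V p :: beads z0) => //.
    transitivity (N ++ V p :: beads z' ++ beads z0).
      by apply: refs_ref; apply: ref_pre.
    by have := refs_app (beads (z' ++ z0)) eN; rewrite beads_cat -catA.
  case: c hok hgok virtual {hpair} => [q|] hok hgok virtual; last exact: (virtual [::]).
  have e1 : refs [::] (w ++ [:: X p (Real q)]) ((N ++ beads z) ++ [:: F p]).
    transitivity ((N ++ beads z) ++ [:: X p (Real q)]); first by rewrite -catA.
    by apply: refs_ref; apply: ref_pre; exact: crossing_change.
  have tNz' : size (tgt [::] (N ++ beads z)) = m by rewrite tgt_cat tgt_beads // sN.
  case: p hp hok hpm hgok virtual e1 => // k _ hok hpm _ virtual e1.
  have [x [s0 sE]] : exists x s0, tgt [::] (N ++ beads z) = x :: s0.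
    by case: (tgt [::] (N ++ beads z)) tNz' hpm => [<- //|x s0]; exists x, s0.
  have /window[u [s1 [v [s0E hu]]]] : k + 2 <= size s0 by move: tNz'; rewrite sE /=; lia.
  case: s1 s0E => [|y [|y' []]] // s0E _.
  have [t [t' h]] := cross_beads_any Y x y y'; have [h1 _] := h u v; rewrite hu in h1.
  apply: (virtual [:: (t, k); (t', k.+1)]); first by rewrite /fits /= andbT; lia.
  transitivity ((N ++ beads z) ++ [:: F k.+1]) => //.
  rewrite catA; apply: refs_pre; rewrite sE s0E beads_cons /= beads_cons /= cats0.
  exact: h1.
Qed.
End Process.

(** * Connectedness and conclusion *)

(** [cout] only relates the bottom and the top; a path also records the colouring at each level
    between, where the points of a diagram lie. *)
Definition colour_path (w : word) (f : nat -> seq bool) :=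
  forall i, i < size w -> f i.+1 \in gcout (nth (0, Kcap) w i) (f i).

Lemma colour_path_cons g w m f : f 0 \in gcout g m -> colour_path w f ->
  colour_path (g :: w) (fun i => if i is j.+1 then f j else m).
Proof. by move=> h0 h [|i] //= hi; apply: h. Qed.

Lemma cout_path w m m' : m' \in cout w m -> exists2 f, f 0 = m & colour_path w f.
Proof.
elim: w m => [|g w IH] m /=; first by exists (fun=> m).
case/flatten_mapP=> m1 h1 /IH[f f0 hf].
by exists (fun i => if i is j.+1 then f j else m) => //; apply: colour_path_cons; rewrite ?f0.
Qed.

Lemma cout_path_through w w' m m1 m2 : m1 \in cout w m -> m2 \in cout w' m1 ->
  exists f, [/\ f 0 = m, f (size w) = m1 & colour_path (w ++ w') f].
Proof.
elim: w m => [|g w IH] m /=.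
  by rewrite inE => /eqP <- /cout_path[f h1 h2]; exists f.
case/flatten_mapP=> m0 h0 h1 /(IH _ h1)[f [f0 f1 hf]].
by exists (fun i => if i is j.+1 then f j else m); split=> //; apply: colour_path_cons; rewrite ?f0.
Qed.

Lemma layer_colour s g m m' e k e' k' : gok s g -> size m = size s -> m' \in gcout g m ->
  layer_arc (glayer s g) (e, k) (e', k') ->
  nth false (if e then m' else m) k = nth false (if e' then m' else m) k'.
Proof.
case/gok_split=> u [x [v [-> -> -> _]]]; rewrite !size_cat => hm.
have /window[mu [me [mv [-> hu he]]]] : size u + size (event_src x) <= size m by lia.
rewrite -hu gcout_cat ?he ?size_event_src // => /mapP[t ht ->] H.
have right x1 x2 n : n = size x1 + size x2 ->
    forall j, nth false (x1 ++ x2 ++ mv) (n + j) = nth false mv j.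
  by move=> -> j; rewrite catA -size_cat nth_cat ltnNge leq_addr addKn.
have left x2 j : j < size u -> nth false (mu ++ x2) j = nth false mu j.
  by move=> hj; rewrite nth_cat hu hj.
have here x2 : nth false (mu ++ x2) (size u) = nth false x2 0.
  by rewrite nth_cat hu ltnn subnn.
have next x2 : nth false (mu ++ x2) (size u).+1 = nth false x2 1.
  by rewrite nth_cat hu ltnNge leqnSn /= subSnn.
have st := size_kcout ht; rewrite size_event_src in he.
inversion H as [k0 h0 E1 E2|k0 h0 E1 E2|c E0 E1 E2|c E0 E1 E2|c c1 c2 E0 E1 E2|c c1 c2 E0 E1 E2];
  subst; simpl in *.
- by rewrite !left.
- by rewrite !right ?size_event_src ?size_event_tgt ?hu ?he ?st.
- rewrite here next; move: ht; rewrite E0 /=; case: (me) => [|? ?] //.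
  by rewrite !inE => /orP[] /eqP->.
- rewrite here next; move: ht; rewrite E0 /=; case: (me) => [|y [|z []]] //=.
  by case: eqP => // ->.
- rewrite here next; move: ht; rewrite E0 /=; case: (me) => [|y [|z []]] //=.
  by rewrite inE => /eqP->.
- rewrite here next; move: ht; rewrite E0 /=; case: (me) => [|y [|z []]] //=.
  by rewrite inE => /eqP->.
Qed.

Lemma size_colour_path s w f : ok s w -> size (f 0) = size s -> colour_path w f ->
  forall i, i <= size w -> size (f i) = size (tgt s (take i w)).
Proof.
elim: w s f => [|g w IH] s f /=; first by move=> _ h _ [].
case/andP=> hg hw h0 hf [|i] //= hi; apply: (IH _ (f \o S)) => // [|j hj]; last exact: (hf j.+1).
rewrite size_gtgt //= -h0; apply: size_gcout; last exact: (hf 0).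
by rewrite h0; case/andP: hg.
Qed.

Lemma nth_interp s w i : i < size w ->
  nth layer0 (interp s w) i = glayer (tgt s (take i w)) (nth (0, Kcap) w i).
Proof. by elim: w s i => [|g w IH] s [|i] //= hi; exact: IH. Qed.

Lemma size_interp s w : size (interp s w) = size w.
Proof. by elim: w s => //= g w IH s; rewrite IH. Qed.

Lemma ok_nth s w i : ok s w -> i < size w -> gok (tgt s (take i w)) (nth (0, Kcap) w i).
Proof. by elim: w s i => [|g w IH] s [|i] //= /andP[h1 h2] hi; last exact: IH. Qed.

Lemma adjacent_colour s w f p q : ok s w -> size (f 0) = size s -> colour_path w f ->
  adjacent (interp s w) p q -> nth false (f p.1) p.2 = nth false (f q.1) q.2.
Proof.
move=> hw h0 hf [i e k e' k']; rewrite size_interp => hi.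
rewrite nth_interp //= => h; have hs := size_colour_path hw h0 hf (ltnW hi).
have := layer_colour (ok_nth hw hi) hs (hf i hi) h.
by case: e e' {h} => [] []; rewrite ?addn0 ?addn1.
Qed.

Lemma interp_point s w i k : ok s w -> i < size w -> k < size (tgt s (take i w)) ->
  is_point (interp s w) (i, k).
Proof.
by move=> hw hi hk; rewrite /is_point /= size_interp hi nth_interp //= layer_src_glayer // ok_nth.
Qed.

Lemma one_component_colour (D : diagram) w f i k i' k' : one_component D ->
  layers D = interp [::] w -> ok [::] w -> f 0 = [::] -> colour_path w f ->
  i < size w -> k < size (f i) -> i' < size w -> k' < size (f i') ->
  nth false (f i) k = nth false (f i') k'.
Proof.
case=> _ hD Dw okw f0 hf hi hk hi' hk'.
have hs j (hj : j <= size w) : size (f j) = size (tgt [::] (take j w)).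
  by apply: size_colour_path => //; rewrite f0.
have [pt pt'] : is_point D (i, k) /\ is_point D (i', k').
  by rewrite Dw; split; apply: interp_point => //; rewrite -hs // ltnW.
have := hD _ _ pt pt'; rewrite Dw.
suff h p q : clos_refl_sym_trans _ (adjacent (interp [::] w)) p q ->
    nth false (f p.1) p.2 = nth false (f q.1) q.2 by move=> /h.
elim=> {p q} [p q|p|p q _ ->|p q r _ -> _ ->] //.
by apply: adjacent_colour => //; rewrite f0.
Qed.

Lemma cout_false_word s w : ok s w ->
  nseq (size (tgt s w)) false \in cout w (nseq (size s) false).
Proof.
elim: w s => [|g w IH] s /=; first by rewrite inE.
case/andP=> hg /IH h; apply/flatten_mapP; exists (nseq (size (gtgt s g)) false) => //.
case/gok_split: hg => u [e [v [-> -> _ ->]]].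
rewrite !size_cat !nseqD.
have := @gcout_cat (event_kind e) (nseq (size u) false) (nseq (size (event_src e)) false)
  (nseq (size v) false).
rewrite !size_nseq size_event_src => -> //.
apply: (map_f (fun r => _ ++ r ++ _)); rewrite size_event_tgt.
by case: e => //= *; rewrite !inE eqxx ?orbT.
Qed.

Section Unknotting.
Context (Y : xmove).
Notation refs := (refs Y).
Notation ref := (ref Y).

(* A maximum that closes an arc not containing the first minimum of the diagram
   would split off a component. *)
Lemma no_split (D : diagram) b w1 p w2 e : one_component D ->
  layers D = interp [::] ((0, Kcup b) :: w1 ++ A p :: w2) ->
  ok [::] ((0, Kcup b) :: w1 ++ A p :: w2) -> tgt [::] ((0, Kcup b) :: w1 ++ A p :: w2) = [::] ->
  e \in cout w1 [:: false; false] -> p.+1 < size e ->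
  (forall r, r < size e -> nth false e r = (r == p) || (r == p.+1)) -> False.
Proof.
move=> hD Dw hw tw he hp hr.
have /window[u [s0 [v [eE hu]]]] : p + 2 <= size e by rewrite addn2.
have e1 : nth false e p = true by rewrite hr ?eqxx //; lia.
have e2 : nth false e p.+1 = true by rewrite hr // eqxx orbT.
case: s0 eE => [|x [|y []]] // eE _.
have xE : x = true by rewrite -e1 eE -hu nth_cat ltnn subnn.
have yE : y = true by rewrite -e2 eE -hu nth_cat ltnNge leqnSn /= subSnn.
rewrite {}xE {}yE in eE.
have hw' : ok [::] (((0, Kcup b) :: w1) ++ A p :: w2) by [].
move: (hw'); rewrite ok_cat => /andP[ok1 ok2].
have se : size (tgt [::] ((0, Kcup b) :: w1)) = size e.
  have := ok_wsize ok1; rewrite /= => h.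
  by symmetry; apply: (@size_cout w1 [:: false; false]) he; exact: h.
move: ok2 => /= /andP[okA ok2].
(* Past the maximum no strand is [true], so the constant colouring [false] continues to the top. *)
have hc : [::] \in cout (A p :: w2) e.
  apply/flatten_mapP; exists (u ++ v).
    by rewrite eE -hu (@gcout_cat Kcap u [:: true; true] v erefl) /= inE.
  have : nseq (size (gtgt (tgt [::] ((0, Kcup b) :: w1)) (p, Kcap))) false = u ++ v.
    have suv : size (gtgt (tgt [::] ((0, Kcup b) :: w1)) (p, Kcap)) = size (u ++ v).
      by rewrite size_gtgt // se eE !size_cat /=; lia.
    rewrite suv; symmetry; apply/all_pred1P/(all_nthP false) => i hi /=.
    have -> : nth false (u ++ v) i = nth false e (if i < p then i else i.+2).
      rewrite eE !nth_cat hu; case: ltnP => h; first by rewrite h.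
      by rewrite ifF ?ifF /=; [congr (nth _ _ _); lia | lia..].
    rewrite hr; first by case: (ltnP i p) => h; lia.
    by move: hi; rewrite eE !size_cat /=; case: (ltnP i p) => h; lia.
  have := cout_false_word ok2; rewrite (_ : tgt _ w2 = [::]); last first.
    by have := tw; rewrite -cat_cons tgt_cat.
  by move=> h <-.
have [f [f0 f1 hf]] := cout_path_through he hc.
pose F i := if i is j.+1 then f j else [::] : seq bool.
have hF : colour_path ((0, Kcup b) :: w1 ++ A p :: w2) F.
  by apply: colour_path_cons hf; rewrite f0.
(* The left leg of the first minimum is coloured [false], the strand [p] just below the maximum
   [true]. *)
have := @one_component_colour D _ F 1 0 (size w1).+1 p hD Dw hw erefl hF.
rewrite /= f0 f1 e1 !size_cat /= => /(_ _ isT _ _) h.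
by move: h; rewrite addnS !ltnS leq_addr (ltnW hp) => /(_ isT isT isT).
Qed.

Lemma beads_absorb b z : fits 2 z -> ref (U 0 b :: beads z) [:: U 0 b].
Proof.
elim: z => [|[t [|l]] z IH] //= hz; first by reflexivity.
by rewrite beads_cons; rewrite -> (bead_absorb Y t b (beads z)), IH; [reflexivity | ].
Qed.

Lemma cap_through w : ref (A 0 :: w) (shift 2 w ++ [:: A 0]).
Proof.
elim: w => [|[n K] w IH]; first by reflexivity.
by rewrite -> (@exch_c Y 0 n Kcap K n.+2), IH; [reflexivity|simpl; lia..].
Qed.

(** A virtual kink reverses the minimum and is absorbed by the maximum. *)
Lemma circle_reversed : refs [::] [:: U 0 false; A 0] [:: U 0 true; A 0].
Proof.
transitivity [:: U 0 true; V 0; A 0].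
  by apply: refs_rev => //; exact (refs_ref _ (ref_app [:: A 0] (kink_cup Y 0 true Virtual))).
rewrite -> (kink_cap Y 0 Virtual); reflexivity.
Qed.

Lemma unknot (D : diagram) : one_component D ->
  clos_refl_sym_trans diagram (x_step Y) D circle.
Proof.
case: D => [[|l T] DP] hD; first by case: (proj1 hD).
case: l DP hD => [[|? ?] [b|?|? ? ?] [|? ?]] // DP hD.
have DP' : tangle_wf [:: b; ~~ b] T [::] by exact: DP.
have := interp_layer_gen DP'; set W := map layer_gen T; case=> okW tgtW intW.
have okw : ok [::] (U 0 b :: W) by exact: okW.
(* The two minima of the first minimum with its zigzag: strand 0 is x, and [W] acts on the strands
   from 2 on until the final [A 0]. *)
set P0 := [:: U 0 b; U 1 (~~ b)].
have full : refs [::] (U 0 b :: W) (P0 ++ shift 2 W ++ [:: A 0]).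
  transitivity (P0 ++ A 0 :: W); last by apply: refs_ref; apply: ref_pre; exact: cap_through.
  apply: (@refs_app Y [::] [:: U 0 b] W [:: U 0 b; U 1 (~~ b); A 0]).
  apply: (@refs_pre Y [::] [:: U 0 b] [::]); apply: refs_rev => [|_].
    exact (refs_ref _ (zigzag_r Y 0 (~~ b))).
  by case: (b).
have [okfull tgtfull] := refs_tgt full okw.
have wD : layers (Diagram DP) = interp [::] (U 0 b :: W).
  by rewrite -[RHS]/(Layer [::] (Cup b) [::] :: interp [:: b; ~~ b] W) intW.
have split_beads W1 W2 : W = W1 ++ W2 -> beaded Y b (P0 ++ shift 2 W1).
  elim/last_ind: W1 W2 => [|W1 [p K] IH] W2 WE.
    exists P0, 4, [::]; split=> //; last by reflexivity.
    have := @Normal_arc b _ _ 1 0 (~~ b) (Normal_base b) isT isT.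
    by rewrite arcE.
  rewrite cat_rcons in WE; rewrite -cats1 shift_cat catA.
  apply: beaded_step; [exact: IH WE | by [] | | ].
    move: okfull; rewrite WE shift_cat -[_ :: W2]cat1s shift_cat !catA !ok_cat.
    by do 2! case/andP => [+ _].
  move=> KE; have {}KE : K = Kcap := KE; subst K; rewrite [(2 + p, Kcap).1]/= add2n.
  set n := size _ => -[M /cout_cat[m1 hm1 hM] hr].
  have okP : ok [::] (P0 ++ shift 2 W1).
    by move: okfull; rewrite WE shift_cat -catA catA ok_cat => /andP[].
  have sM : size M = n.
    apply: (@size_cout (P0 ++ shift 2 W1) [::]); last by apply/cout_cat; exists m1.
    exact: (ok_wsize okP).
  have [c [c' m1E]] : exists c c', m1 = [:: c'; c; c; c'].
    by move: hm1; rewrite /= !inE => /or4P[] /eqP->; repeat eexists.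
  have hW1 : wsize 2 W1.
    move: okW; rewrite WE ok_cat => /andP[h _].
    by rewrite -[2]/(size [:: b; ~~ b]) (ok_wsize h).
  move: hM; rewrite m1E -[[:: c'; c; c; c']]/([:: c'; c] ++ [:: c; c'] ++ [::]).
  rewrite (@cout_shift [:: c'; c]) // => /mapP[e he ME]; rewrite cats0 in ME.
  have [c'E cE] : c' = false /\ c = false.
    by split; [have := hr 0 | have := hr 1]; rewrite -sM ME /= => /(_ isT).
  subst c c'.
  have okA : (2 + p) + 2 <= n.
    move: okfull; rewrite WE shift_cat -catA catA ok_cat => /andP[_].
    by rewrite [ok _ _]/= -/(P0 ++ shift 2 W1) => /andP[/andP[]].
  have se : n = (size e).+2 by rewrite -sM ME.
  apply: (@no_split (Diagram DP) b W1 p W2 e hD); rewrite -?WE //.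
    by rewrite se in okA; move: okA; rewrite !addn2.
  move=> r hre; have := hr r.+2; rewrite ME /= se !ltnS => /(_ hre).
  by rewrite !eqSS.
have [N [m [z [hN hz e]]]] := split_beads W [::] (esym (cats0 W)).
have [okP] : ok [::] (P0 ++ shift 2 W) /\ size (tgt [::] (P0 ++ shift 2 W)) = 2.
  move: okfull; rewrite catA ok_cat => /andP[h1 /andP[h2 _]]; split=> //.
  move: tgtfull; rewrite catA tgt_cat /= => tE.
  have := size_gtgt h2; rewrite tE tgtW /=; move: h2 => /andP[/= h2 _]; lia.
have [okN sN] := normal_ok hN; have [_ tN] := refs_tgt e okP.
rewrite -tN tgt_cat tgt_beads ?sN // => m2; rewrite {}m2 in hN hz.
(* Each arc adds two strands to at least two, so only the base has exactly two. *)
have NE : N = [:: U 0 b].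
  have gen N' m' : normal b N' m' -> m' = 2 -> N' = [:: U 0 b].
    by case=> // N1 m1 i k a /normal_ge2 hm _ _ [m10]; rewrite m10 in hm.
  exact: gen hN erefl.
have final : refs [::] (U 0 b :: W) [:: U 0 b; A 0].
  transitivity (P0 ++ shift 2 W ++ [:: A 0]) => //.
  transitivity ((N ++ beads z) ++ [:: A 0]); first by rewrite catA; exact: refs_app.
  by rewrite NE; rewrite -> (beads_absorb b hz); reflexivity.
have {final} : refs [::] (U 0 b :: W) [:: U 0 true; A 0].
  by case: (b) final => // h; transitivity [:: U 0 false; A 0] => //; exact: circle_reversed.
case=> /(_ okw)[_ _ h _]; apply: tequiv_diagram.
by move: h; rewrite -wD (_ : tgt _ _ = [::]).
Qed.

End Unknotting.

Theorem lemma5p1 (X : xmove) :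
  (forall K K' : virtual_knot, x_equivalent X K K') /\
  (forall K : virtual_knot, x_equivalent X K trivial_knot).
Proof.
suff h K K' : x_equivalent X K K' by [].
have [D [hD DE]] := virtual_knotP K; have [D' [hD' DE']] := virtual_knotP K'.
exists D, D'; split; [apply/DE; exact: rst_refl | apply/DE'; exact: rst_refl |].
exact: rst_trans (unknot X hD) (rst_sym _ _ _ _ (unknot X hD')).
Qed.
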